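(* Let $(M,I,J,K)$ be a hypercomplex manifold, $\nabla$ its Obata connection with curvature $R$, $x_0\in M$, and let $\{z^r\}$ be $I$-holomorphic coordinates around $x_0$ that are geodesic with respect to $\nabla$ at $x_0$. Let $g$ be a hyperhermitian metric on $(M,I,J,K)$. Then, for all indices $q,a$, $$g^{i\bar j}R_{\bar j i\bar q}{}^{\bar a}=0\quad\text{at }x_0 .$$ In particular, if $\hat g$ is a hyperkähler metric on $(M,I,J,K)$, then for every hyperhermitian metric $g$ on $(M,I,J,K)$ and all indices $r,s$, $$g^{i\bar j}\,\hat g_{i\bar k}\,R_{\bar s r\bar j}{}^{\bar k}=0\quad\text{at }x_0 .$$
   Context: A hypercomplex manifold $(M,I,J,K)$ is a smooth manifold of real dimension $4n$ with three (integrable) complex structures satisfying $IJ=-JI=K$. A Riemannian metric $g$ is hyperhermitian if $g(I\cdot,I\cdot)=g(J\cdot,J\cdot)=g(K\cdot,K\cdot)=g$; it is hyperkähler if moreover $\Omega=\tfrac12(g(J\cdot,\cdot)+i\,g(K\cdot,\cdot))$ is closed (equivalently, $I,J,K$ are parallel for its Levi-Civita connection). The Obata connection $\nabla$ is the unique torsion-free affine connection with $\nabla I=\nabla J=\nabla K=0$; if $\hat g$ is hyperkähler, $\nabla$ is the Levi-Civita connection of $\hat g$. Coordinates are geodesic with respect to $\nabla$ at $x_0$ if all Christoffel symbols of $\nabla$ vanish at $x_0$; such $I$-holomorphic coordinates exist around every point. The curvature is $R(X,Y)=\nabla_X\nabla_Y-\nabla_Y\nabla_X-\nabla_{[X,Y]}$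 with components $$R\left(\frac{\partial}{\partial\bar z^j},\frac{\partial}{\partial z^k}\right)\frac{\partial}{\partial\bar z^l}=R_{\bar jk\bar l}{}^{\bar i}\frac{\partial}{\partial\bar z^i}.$$ All components are with respect to the coordinates $z^1,\dots,z^{2n}$; $g_{i\bar j}=g(\partial_{z^i},\partial_{\bar z^j})$, $(g^{i\bar j})$ is the inverse matrix (similarly for $\hat g$), and repeated indices are summed. *)

(* Defs.v *)
From HB Require Import structures.
From mathcomp Require Import all_boot all_order all_algebra.
From mathcomp Require Import all_classical all_reals all_analysis.
From mathcomp Require Import complex ring.
Set Implicit Arguments.
Unset Strict Implicit.
Unset Printing Implicit Defensive.
Import Order.TTheory GRing.Theory Num.Theory.
Import numFieldNormedType.Exports.
Local Open Scope classical_set_scope.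
Local Open Scope ring_scope.

(* Points of R^d and tangent vectors are column vectors, so that a matrix acts
   on tangent vectors from the left and composition of endomorphisms is [*m].
   A section of TM (x) C over a coordinate domain is an [R[i]]-valued column;
   the connection, bracket, curvature and metric are extended C-multilinearly. *)

Section Calculus.
Variables (R : realType) (d : nat).
Implicit Types (U : set 'cV[R]_d) (x : 'cV[R]_d).

Definition partial (i : 'I_d) (f : 'cV[R]_d -> R) : 'cV[R]_d -> R :=
  fun x => 'D_(delta_mx i 0) f x.

(* For U open: f is C^k on U. *)
Fixpoint Ck (k : nat) U (f : 'cV[R]_d -> R) : Prop :=
  (forall x, U x -> {for x, continuous f}) /\
  if k is k'.+1 then
    forall i : 'I_d, (forall x, U x -> derivable f x (delta_mx i 0)) /\
                     Ck k' U (partial i f)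
  else True.

Definition smooth U (f : 'cV[R]_d -> R) : Prop := forall k, Ck k U f.

Definition jacobian_mx (f : 'cV[R]_d -> 'cV[R]_d) x : 'M[R]_d :=
  \matrix_(a, b) partial b (fun y => f y a 0) x.

Definition hessian (f : 'cV[R]_d -> 'cV[R]_d) x (a i j : 'I_d) : R :=
  partial i (partial j (fun y => f y a 0)) x.

Definition cpartial (i : 'I_d) (f : 'cV[R]_d -> R[i]) : 'cV[R]_d -> R[i] :=
  fun x => (partial i (fun y => complex.Re (f y)) x
            +i* partial i (fun y => complex.Im (f y)) x)%C.

Definition cvfield := 'cV[R]_d -> 'cV[R[i]]_d.

Definition smooth_cvfield U (X : cvfield) : Prop :=
  forall a, smooth U (fun x => complex.Re (X x a 0)) /\
            smooth U (fun x => complex.Im (X x a 0)).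

Definition toC m n (A : 'M[R]_(m, n)) : 'M[R[i]]_(m, n) :=
  map_mx (real_complex R) A.

Definition apply_field (A : 'cV[R]_d -> 'M[R]_d) (X : cvfield) : cvfield :=
  fun x => toC (A x) *m X x.

Definition along (X : cvfield) (f : 'cV[R]_d -> R[i]) : 'cV[R]_d -> R[i] :=
  fun x => \sum_(i < d) X x i 0 * cpartial i f x.

Definition lie (X Y : cvfield) : cvfield := fun x =>
  \col_a (along X (fun y => Y y a 0) x - along Y (fun y => X y a 0) x).

(* [G x a b c] is the Christoffel symbol Gamma^a_{bc}, i.e.
   nabla_{d_b} d_c = Gamma^a_{bc} d_a. *)
Definition christoffel_array := 'cV[R]_d -> 'I_d -> 'I_d -> 'I_d -> R.

Definition covD (G : christoffel_array) (X Y : cvfield) : cvfield := fun x =>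
  \col_a (along X (fun y => Y y a 0) x +
          \sum_(b < d) \sum_(c < d) (G x a b c)%:C%C * X x b 0 * Y x c 0).

Definition torsion (G : christoffel_array) (X Y : cvfield) : cvfield :=
  fun x => covD G X Y x - covD G Y X x - lie X Y x.

Definition curvature (G : christoffel_array) (X Y Z : cvfield) : cvfield :=
  fun x => covD G X (covD G Y Z) x - covD G Y (covD G X Z) x
           - covD G (lie X Y) Z x.

(* Components of the exterior derivative of the 2-form with components [w]. *)
Definition dform2 (w : 'cV[R]_d -> 'M[R[i]]_d) x (a b c : 'I_d) : R[i] :=
  cpartial a (fun y => w y b c) x + cpartial b (fun y => w y c a) x
  + cpartial c (fun y => w y a b) x.

Definition cbilin (G : 'M[R]_d) (u v : 'cV[R[i]]_d) : R[i] :=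
  (u^T *m toC G *m v) 0 0.

End Calculus.

Section Manifolds.
Variables (R : realType) (d : nat).

Record chart (T : topologicalType) := Chart {
  dom : set T;
  cod : set 'cV[R]_d;
  to : T -> 'cV[R]_d;
  from : 'cV[R]_d -> T;
  _ : open dom;
  _ : open cod;
  _ : forall p, dom p -> cod (to p) /\ from (to p) = p;
  _ : forall x, cod x -> dom (from x) /\ to (from x) = x;
  _ : {within dom, continuous to};
  _ : {within cod, continuous from}
}.

Definition transition T (c c' : chart T) : 'cV[R]_d -> 'cV[R]_d :=
  fun x => to c' (from c x).

Definition smooth_transition T (c c' : chart T) : Prop :=
  forall a, smooth (cod c `&` [set x | dom c' (from c x)])
                   (fun x => transition c c' x a 0).

Definition compatible T (c c' : chart T) : Prop :=
  smooth_transition c c' /\ smooth_transition c' c.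

Record smooth_manifold := SmoothManifold {
  points :> topologicalType;
  atlas : set (chart points);
  _ : hausdorff_space points;
  _ : @second_countable points;
  _ : forall p : points, exists2 c, atlas c & dom c p;
  _ : forall c c', atlas c -> atlas c' -> compatible c c';
  _ : forall c, (forall c', atlas c' -> compatible c c') -> atlas c
}.

Variable M : smooth_manifold.
Implicit Types (c : chart M) (p : M).

(* Tensor fields and connections are given, classically, by their components in
   every chart of the atlas together with the transformation law on overlaps.
   The transition from c to c' maps the coordinates in c to those in c'. *)

Definition endo_law (A : chart M -> 'cV[R]_d -> 'M[R]_d) : Prop :=
  forall c c' p, atlas c -> atlas c' -> dom c p -> dom c' p ->
  let D := jacobian_mx (transition c c') (to c p) in
  A c' (to c' p) *m D = D *m A c (to c p).

Record endo_field := EndoField {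
  endo :> chart M -> 'cV[R]_d -> 'M[R]_d;
  _ : forall c, atlas c -> forall a b, smooth (cod c) (fun x => endo c x a b);
  _ : endo_law endo
}.

Definition metric_law (g : chart M -> 'cV[R]_d -> 'M[R]_d) : Prop :=
  forall c c' p, atlas c -> atlas c' -> dom c p -> dom c' p ->
  let D := jacobian_mx (transition c c') (to c p) in
  g c (to c p) = D^T *m g c' (to c' p) *m D.

Record riemannian_metric := RiemannianMetric {
  metric :> chart M -> 'cV[R]_d -> 'M[R]_d;
  _ : forall c, atlas c -> forall a b, smooth (cod c) (fun x => metric c x a b);
  _ : forall c, atlas c -> forall x, cod c x -> (metric c x)^T = metric c x;
  _ : forall c, atlas c -> forall x, cod c x ->
        forall v : 'cV[R]_d, v != 0 -> 0 < (v^T *m metric c x *m v) 0 0;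
  _ : metric_law metric
}.

(* From d_i = (d y^b / d x^i) d_b applied to nabla_{d_i} d_j, where x are the
   coordinates of c and y those of c'. *)
Definition connection_law (G : chart M -> christoffel_array R d) : Prop :=
  forall c c' p, atlas c -> atlas c' -> dom c p -> dom c' p ->
  let D := jacobian_mx (transition c c') (to c p) in
  forall a i j : 'I_d,
    hessian (transition c c') (to c p) a i j +
    \sum_(b < d) \sum_(e < d) G c' (to c' p) a b e * D b i * D e j =
    \sum_(k < d) D a k * G c (to c p) k i j.

Record affine_connection := AffineConnection {
  christoffel :> chart M -> christoffel_array R d;
  _ : forall c, atlas c ->
        forall a i j, smooth (cod c) (fun x => christoffel c x a i j);
  _ : connection_law christoffel
}.

Definition torsion_free (nabla : affine_connection) : Prop :=
  forall c X Y x, atlas c -> cod c x ->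
  smooth_cvfield (cod c) X -> smooth_cvfield (cod c) Y ->
  torsion (nabla c) X Y x = 0.

Definition parallel_endo (nabla : affine_connection) (A : endo_field) : Prop :=
  forall c X Y x, atlas c -> cod c x ->
  smooth_cvfield (cod c) X -> smooth_cvfield (cod c) Y ->
  covD (nabla c) X (apply_field (A c) Y) x = toC (A c x) *m covD (nabla c) X Y x.

End Manifolds.

(* Complex coordinates on R^(N+N): z^r = x^r + i y^r, where x^r is the real
   coordinate of index [lshift N r] and y^r the one of index [rshift N r].
   An index [inl r] stands for z^r, an index [inr r] for its conjugate. *)
Section ComplexFrame.
Variables (R : realType) (N : nat).

Definition cframe (s : 'I_N + 'I_N) : 'cV[R[i]]_(N + N) :=
  match s with
  | inl r => 2^-1 *: (delta_mx (lshift N r) 0 - 'i%C *: delta_mx (rshift N r) 0)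
  | inr r => 2^-1 *: (delta_mx (lshift N r) 0 + 'i%C *: delta_mx (rshift N r) 0)
  end.

Definition ccoframe (s : 'I_N + 'I_N) : 'rV[R[i]]_(N + N) :=
  match s with
  | inl r => delta_mx 0 (lshift N r) + 'i%C *: delta_mx 0 (rshift N r)
  | inr r => delta_mx 0 (lshift N r) - 'i%C *: delta_mx 0 (rshift N r)
  end.

Definition cfield (s : 'I_N + 'I_N) : cvfield R (N + N) := fun=> cframe s.

End ComplexFrame.
Arguments cframe {R N} s.
Arguments ccoframe {R N} s.
Arguments cfield {R N} s.

Lemma cframe_decomp (R : realType) (N : nat) (v : 'cV[R[i]]_(N + N)) :
  v = \sum_s (ccoframe s *m v) 0 0 *: cframe s.
Proof.
have cof b r : (ccoframe (if b then inl r else inr r) *m v) 0 0 =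
    v (lshift N r) 0 + (if b then 'i%C else - 'i%C) * v (rshift N r) 0.
  by case: b; rewrite /= ?mulmxBl ?mulmxDl -scalemxAl -!rowE !mxE ?mulNr.
have delta_l (i j : 'I_N) :
    (lshift N i == lshift N j) = (i == j) by exact: (inj_eq (@lshift_inj _ _)).
have delta_r (i j : 'I_N) :
    (rshift N i == rshift N j) = (i == j) by exact: (inj_eq (@rshift_inj _ _)).
have i2 : 'i%C * 'i%C = -1 :> R[i] by rewrite -expr2 sqr_i.
have h2 : (2 : R[i]) != 0 by rewrite pnatr_eq0.
apply/colP => a; rewrite summxE big_sumType /= -big_split /=.
under eq_bigr => r _ do rewrite (cof true r) (cof false r) !mxE.
case: (split_ordP a) => r ->; rewrite (bigD1 r) //= big1 ?addr0;
  try by move=> t; rewrite eq_sym => /negPf tr;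
    rewrite ?eq_lrshift ?eq_rlshift ?delta_l ?delta_r tr /= !(mulr0, addr0, subr0).
- rewrite !eqxx eq_lrshift /=; set x := v _ _; set y := v _ _.
  by field.
- rewrite !eqxx eq_rlshift /=; set x := v _ _; set y := v _ _.
  transitivity (- ('i%C * 'i%C) * x); first by rewrite i2 opprK mul1r.
  by field.
Qed.

Section Hypercomplex.
Variables (R : realType) (N : nat) (M : smooth_manifold R (N + N)).
Implicit Types (A I J K : endo_field M) (g : riemannian_metric M).

Definition holomorphic_chart A (z : chart R (N + N) M) : Prop :=
  forall x, cod z x -> forall r : 'I_N,
  ccoframe (inl r) *m toC (A z x) = 'i%C *: ccoframe (inl r).

Definition complex_structure A : Prop :=
  (forall c x, atlas c -> cod c x -> A c x *m A c x = - 1%:M) /\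
  (forall p : M, exists c, [/\ atlas c, dom c p & holomorphic_chart A c]).

Definition hypercomplex I J K : Prop :=
  [/\ complex_structure I, complex_structure J, complex_structure K &
   forall c x, atlas c -> cod c x ->
     I c x *m J c x = K c x /\ - (J c x *m I c x) = K c x].

Definition obata (nabla : affine_connection M) I J K : Prop :=
  [/\ torsion_free nabla, parallel_endo nabla I,
      parallel_endo nabla J & parallel_endo nabla K].

Definition hermitian g A : Prop :=
  forall c x, atlas c -> cod c x -> (A c x)^T *m g c x *m A c x = g c x.

Definition hyperhermitian g I J K : Prop :=
  [/\ hermitian g I, hermitian g J & hermitian g K].

(* Omega = (g(J.,.) + i g(K.,.)) / 2. *)
Definition Omega g J K (c : chart R (N + N) M) (x : 'cV[R]_(N + N)) :
    'M[R[i]]_(N + N) :=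
  2^-1 *: (toC ((J c x)^T *m g c x) + 'i%C *: toC ((K c x)^T *m g c x)).

Definition hyperkahler g I J K : Prop :=
  hyperhermitian g I J K /\
  forall c x, atlas c -> cod c x ->
  forall a b e, dform2 (Omega g J K c) x a b e = 0.

(* All components of [nabla_{d_s} d_t] in the frame d/dz^r, d/dzbar^r vanish. *)
Definition geodesic_at (nabla : affine_connection M) (z : chart R (N + N) M)
    (p : M) : Prop :=
  forall s t u : 'I_N + 'I_N,
  (ccoframe u *m covD (nabla z) (cfield s) (cfield t) (to z p)) 0 0 = 0.

(* R_{\bar j k \bar l}^{\bar i}; the upper index comes last. *)
Definition curv_comp (nabla : affine_connection M) (z : chart R (N + N) M)
    (p : M) (j k l i : 'I_N) : R[i] :=
  (ccoframe (inr i) *m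
   curvature (nabla z) (cfield (inr j)) (cfield (inl k)) (cfield (inr l))
     (to z p)) 0 0.

(* g_{i \bar j}. *)
Definition metric_comp g (z : chart R (N + N) M) (p : M) : 'M[R[i]]_N :=
  \matrix_(i, j) cbilin (g z (to z p)) (cframe (inl i)) (cframe (inr j)).

(* g^{i \bar j}: the index positions force the inverse to be transposed, so that
   g^{i \bar j} g_{k \bar j} = delta^i_k. *)
Definition metric_inv g (z : chart R (N + N) M) (p : M) (i j : 'I_N) : R[i] :=
  invmx (metric_comp g z p) j i.

End Hypercomplex.

(* Main.v *)
(** The curvature [T] of the Obata connection commutes with I, J, K and satisfies
    the first Bianchi identity.  Bianchi on vectors of type (1,0), (1,0), (0,1)
    for J shows that the (2,0)-part of [T] kills (0,1)-vectors; as I exchanges the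
    two types, that part vanishes, so [T(JX, JY) = T(X, Y)].  The inverse metric
    H of a hyperhermitian metric is J-invariant while I H is J-anti-invariant and
    skew, so [T] contracted with I H is zero.  Since the bivector
    g^{i\bar j} d_i (x) d_{\bar j} is (H - i I H) / 2 and H is symmetric, the whole
    endomorphism g^{i\bar j} R(d_{\bar j}, d_i) vanishes.  If \hat g is
    hyperkahler, closedness of Omega forces nabla \hat g = 0, and the resulting
    pair symmetry of the lowered curvature reduces the second identity to the
    first. *)
From HB Require Import structures.
Require Import Defs.
From mathcomp Require Import all_boot all_order all_algebra.
From mathcomp Require Import all_classical all_reals all_analysis.
From mathcomp Require Import complex ring lra.
Set Implicit Arguments.
Unset Strict Implicit.
Unset Printing Implicit Defensive.
Import Order.TTheory GRing.Theory Num.Theory.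
Import numFieldNormedType.Exports.
Local Open Scope classical_set_scope.
Local Open Scope ring_scope.

(** * Symmetry of second directional derivatives *)

Section Schwarz.
Variables (R : realType) (V : normedModType R).
Implicit Types (f : V -> R) (x u v : V).

Lemma is_derive_line f x v (t : R) : derivable f (x + t *: v) v ->
  is_derive t 1 (fun s => f (x + s *: v)) ('D_v f (x + t *: v)).
Proof.
have E : (fun h : R => h^-1 *: (f (x + (h *: 1 + t) *: v) - f (x + t *: v))) =
         (fun h : R => h^-1 *: (f (h *: v + (x + t *: v)) - f (x + t *: v))).
  apply/funext => h; congr (_ *: (f _ - _)).
  by rewrite [h *: 1]mulr1 scalerDl addrCA.
by move=> fd; split; rewrite /derivable /derive/= E.
Qed.

Lemma MVT_line f x v (h : R) : 0 < h ->
  (forall t, 0 <= t <= h -> derivable f (x + t *: v) v) ->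
  exists2 t, 0 <= t <= h & f (x + h *: v) - f x = h * 'D_v f (x + t *: v).
Proof.
move=> h0 fd; have [t||t] := @MVT R (fun s => f (x + s *: v))
    (fun s => 'D_v f (x + s *: v)) 0 h h0.
- by rewrite in_itv/= => /andP[t0 th]; apply/is_derive_line/fd; rewrite !ltW.
- apply: derivable_within_continuous => t.
  rewrite in_itv/= => tI; exact: (@ex_derive _ _ _ _ _ _ _ (is_derive_line (fd _ tI))).
rewrite in_itv/= => /andP[t0 th]; rewrite scale0r addr0 subr0 => e.
by exists t; rewrite ?(ltW t0) ?(ltW th)// e mulrC.
Qed.

(** Two uses of the mean value theorem: first along u for the increment
    [g y = f (y + h *: v) - f y], then along v for ['D_u f]. *)
Lemma second_difference f x u v (h : R) : 0 < h ->
  (forall s t, 0 <= s <= h -> 0 <= t <= h ->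
    derivable f (x + s *: u + t *: v) u /\
    derivable ('D_u f) (x + s *: u + t *: v) v) ->
  exists s t, [/\ 0 <= s <= h, 0 <= t <= h &
   f (x + h *: u + h *: v) - f (x + h *: u) - (f (x + h *: v) - f x) =
   h * h * 'D_v ('D_u f) (x + s *: u + t *: v)].
Proof.
move=> h0 fd; have h0h : 0 <= h <= h by rewrite lexx ltW.
have h00 : (0 : R) <= 0 <= h by rewrite lexx ltW.
pose g y := f (y + h *: v) - f y.
have shd y : derivable f (y + h *: v) u ->
   is_derive y u (fun z => f (z + h *: v)) ('D_u f (y + h *: v)).
  have E : (fun k : R => k^-1 *: (f (k *: u + y + h *: v) - f (y + h *: v))) =
           (fun k : R => k^-1 *: (f (k *: u + (y + h *: v)) - f (y + h *: v))).
    by apply/funext => k; rewrite addrA.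
  by move=> d; split; rewrite /derivable /derive/= E.
have gd s : 0 <= s <= h -> is_derive (x + s *: u) u g
    ('D_u f (x + s *: u + h *: v) - 'D_u f (x + s *: u)).
  move=> sI; apply: is_deriveB; first by apply: shd; exact: (fd _ _ _ _).1.
  apply: derivableP; have := (fd s 0 sI h00).1.
  by rewrite scale0r addr0.
have [|s sI] := @MVT_line g x u h h0.
  by move=> s sI; exact: (@ex_derive _ _ _ _ _ _ _ (gd s sI)).
rewrite (@derive_val _ _ _ _ _ _ _ (gd s sI)) /g => e.
have [|t tI et] := @MVT_line ('D_u f) (x + s *: u) v h h0.
  by move=> t tI; exact: (fd _ _ _ _).2.
by exists s, t; split => //; rewrite e et mulrA.
Qed.

(** The second difference is symmetric in u and v. It therefore equals h^2 times either mixed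
    derivative, each at some point of a small parallelogram at x, and continuity at x makes the two
    values arbitrarily close. *)
Lemma schwarz_derive (U : set V) f x u v : open U -> U x ->
  (forall y, U y -> derivable f y u /\ derivable f y v) ->
  (forall y, U y -> derivable ('D_u f) y v /\ derivable ('D_v f) y u) ->
  {for x, continuous ('D_v ('D_u f))} -> {for x, continuous ('D_u ('D_v f))} ->
  'D_v ('D_u f) x = 'D_u ('D_v f) x.
Proof.
move=> Uo Ux fd fdd cvu cuv; apply/eqP; rewrite -subr_eq0 -normr_le0.
apply/ler_addgt0Pl => e e0; rewrite addr0.
have e2 : 0 < e / 2 by rewrite divr_gt0.
have N1 : \forall y \near x, `|'D_v ('D_u f) x - 'D_v ('D_u f) y| < e / 2.
  by move/cvgrPdist_lt: cvu; apply.
have N2 : \forall y \near x, `|'D_u ('D_v f) x - 'D_u ('D_v f) y| < e / 2.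
  by move/cvgrPdist_lt: cuv; apply.
have N3 : \forall y \near x, U y by exact: open_nbhs_nbhs.
have [r /= r0 rB] := (nbhs_ballP _ _).1 (filterI (filterI N1 N2) N3).
(* This size keeps the whole parallelogram x + s u + t v, with s and t in [0, h], inside the ball of
   radius r. The summand 1 keeps the divisor positive when u = v = 0, and the half gives strict
   inequality. *)
pose h := r / 2 / (1 + `|u| + `|v|).
have D0 : 0 < 1 + `|u| + `|v| by rewrite -addrA ltr_wpDr ?addr_ge0.
have h0 : 0 < h by rewrite !divr_gt0.
have B s t : 0 <= s <= h -> 0 <= t <= h -> ball x r (x + s *: u + t *: v).
  move=> /andP[s0 sh] /andP[t0 th].
  rewrite -ball_normE /= -addrA opprD addNKr normrN.
  apply: le_lt_trans (ler_normD _ _) _; rewrite !normrZ (ger0_norm s0) (ger0_norm t0).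
  have : s * `|u| + t * `|v| <= h * (1 + `|u| + `|v|).
    have := ler_wpM2r (normr_ge0 u) sh; have := ler_wpM2r (normr_ge0 v) th.
    by lra.
  move=> /le_lt_trans; apply; rewrite /h divfK ?gt_eqF// ltr_pdivrMr//.
  by rewrite mulr2n mulrDr mulr1 ltrDl.
have [|s [t [sI tI e1]]] := @second_difference f x u v h h0.
  move=> s t sI tI; have [_ /= Us] := rB _ (B s t sI tI).
  by split; [exact: (fd _ Us).1|exact: (fdd _ Us).1].
have [|t' [s' [tI' sI' e2']]] := @second_difference f x v u h h0.
  move=> t' s' tI' sI'; have := B s' t' sI' tI'.
  rewrite addrAC => /rB[_ /= Us].
  by split; [exact: (fd _ Us).2|exact: (fdd _ Us).2].
have [[/= A1 _] _] := rB _ (B s t sI tI).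
have [[/= _ A2] _] := rB _ (B s' t' sI' tI').
rewrite (addrAC x) in A2.
have hh : h * h != 0 by rewrite mulf_neq0 ?gt_eqF.
have E : 'D_v ('D_u f) (x + s *: u + t *: v) = 'D_u ('D_v f) (x + t' *: v + s' *: u).
  apply: (mulfI hh); apply: etrans (esym e1) _; apply: etrans _ e2'.
  rewrite (addrAC x (h *: v)).
  by rewrite !opprB addrACA [RHS]addrACA; congr (_ + _); rewrite addrC.
rewrite E in A1; set a := 'D_v ('D_u f) x in A1 *; set b := 'D_u ('D_v f) x in A2 *.
set c := 'D_u ('D_v f) _ in A1 A2.
rewrite (_ : a - b = (a - c) - (b - c)); last by rewrite opprB addrA subrK.
apply: le_trans (ler_normB _ _) _.
have := ltrD A1 A2; rewrite -splitr; exact: ltW.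
Qed.

End Schwarz.

Lemma eq_opp_eq0 (F : numFieldType) (V : lmodType F) (v : V) : v = - v -> v = 0.
Proof.
move=> /eqP; rewrite -subr_eq0 opprK -mulr2n -scaler_nat scaler_eq0.
by rewrite pnatr_eq0 => /eqP.
Qed.

Lemma trmxB (F : zmodType) m n (A B : 'M[F]_(m, n)) : (A - B)^T = A^T - B^T.
Proof. exact: raddfB. Qed.

(** * Contraction of an endomorphism-valued tensor with a bivector *)

Section Contract.
Variables (F : comNzRingType) (d : nat) (T : 'I_d -> 'I_d -> 'M[F]_d).

(** With [W = X *m Y^T] this is the endomorphism T(X, Y). General W are allowed so that inverse
    metrics can be contracted as well. *)
Definition bicontract (W : 'M[F]_d) : 'M[F]_d :=
  \sum_(b < d) \sum_(c < d) W b c *: T b c.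

Fact bicontract_is_linear : linear bicontract.
Proof.
move=> k A B; rewrite /bicontract scaler_sumr -big_split; apply: eq_bigr => b _.
rewrite scaler_sumr -big_split; apply: eq_bigr => c _.
by rewrite !mxE scalerDl scalerA.
Qed.
HB.instance Definition _ :=
  GRing.isLinear.Build F 'M[F]_d 'M[F]_d _ bicontract bicontract_is_linear.

Lemma bicontract_tr (W : 'M[F]_d) : (forall b c, T b c = - T c b) ->
  bicontract W^T = - bicontract W.
Proof.
move=> Tanti; rewrite /bicontract exchange_big -sumrN; apply: eq_bigr => b _.
by rewrite -sumrN; apply: eq_bigr => c _; rewrite mxE Tanti scalerN.
Qed.

Lemma bicontract_comm (A W : 'M[F]_d) : (forall b c, T b c *m A = A *m T b c) ->
  bicontract W *m A = A *m bicontract W.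
Proof.
move=> TA; rewrite mulmx_suml mulmx_sumr; apply: eq_bigr => b _.
rewrite mulmx_suml mulmx_sumr; apply: eq_bigr => c _.
by rewrite -scalemxAl -scalemxAr TA.
Qed.

(** Trilinear extension of the identity on basis vectors. The entry [T b c a e] is the a-th
    component of T(d_b, d_c) d_e, so the cyclic sum runs over b, c, e. *)
Lemma bicontract_bianchi (X Y Z : 'cV[F]_d) :
  (forall a b c e, T b c a e + T c e a b + T e b a c = 0) ->
  bicontract (X *m Y^T) *m Z + bicontract (Y *m Z^T) *m X
  + bicontract (Z *m X^T) *m Y = 0.
Proof.
have E (X' Y' Z' : 'cV[F]_d) a : (bicontract (X' *m Y'^T) *m Z') a 0 =
   \sum_b \sum_c \sum_e X' b 0 * Y' c 0 * Z' e 0 * T b c a e.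
  rewrite mulmx_suml summxE; apply: eq_bigr => b _.
  rewrite mulmx_suml summxE; apply: eq_bigr => c _.
  rewrite mxE; apply: eq_bigr => e _; rewrite !mxE big_ord1 !mxE; ring.
move=> Tb; apply/colP => a.
rewrite [LHS]mxE [X in X + _]mxE !E [RHS]mxE.
(* The other two cyclic terms are reindexed so that all three sums carry the coefficient X_b Y_c
   Z_e. *)
rewrite [X in _ + X + _](_ : _ = \sum_b \sum_c \sum_e
    X b 0 * Y c 0 * Z e 0 * T c e a b); last first.
  under eq_bigr do rewrite exchange_big.
  rewrite exchange_big; do 3!apply: eq_bigr => ? _; ring.
rewrite [X in _ + X](_ : _ = \sum_b \sum_c \sum_e
    X b 0 * Y c 0 * Z e 0 * T e b a c); last first.
  rewrite exchange_big; apply: eq_bigr => ? _.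
  rewrite exchange_big; do 2!apply: eq_bigr => ? _; ring.
rewrite -!big_split big1// => b _; rewrite -!big_split big1// => c _.
rewrite -!big_split big1// => e _ /=.
by rewrite -!mulrDr Tb mulr0.
Qed.

End Contract.

(** * Curvature tensors commuting with I and J *)

Section JInvariance.
Variables (F : realFieldType) (d : nat) (T : 'I_d -> 'I_d -> 'M[F]_d).
Variables (I J : 'M[F]_d).
Hypotheses (Tanti : forall b c, T b c = - T c b)
  (Tbianchi : forall a b c e, T b c a e + T c e a b + T e b a c = 0)
  (TI : forall b c, T b c *m I = I *m T b c)
  (TJ : forall b c, T b c *m J = J *m T b c)
  (II : I *m I = - 1%:M) (JJ : J *m J = - 1%:M) (IJ : J *m I = - (I *m J)).

Let Q (X Y : 'cV[F]_d) := bicontract T (X *m Y^T).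

Let JQ X Y : J *m Q X Y = Q X Y *m J.
Proof. by rewrite /Q bicontract_comm. Qed.

Let QNl X Y : Q (- X) Y = - Q X Y.
Proof. by rewrite /Q mulNmx raddfN. Qed.

Let QNr X Y : Q X (- Y) = - Q X Y.
Proof. by rewrite /Q linearN mulmxN raddfN. Qed.

Let JJE m (X : 'M[F]_(d, m)) : J *m (J *m X) = - X.
Proof. by rewrite mulmxA JJ mulNmx mul1mx. Qed.

Let QJ X Y (Z : 'cV[F]_d) : Q X Y *m (J *m Z) = J *m (Q X Y *m Z).
Proof. by rewrite !mulmxA JQ. Qed.

Let IIE m (X : 'M[F]_(d, m)) : I *m (I *m X) = - X.
Proof. by rewrite mulmxA II mulNmx mul1mx. Qed.

(** Twice the sum of the (2,0) and (0,2) parts of T with respect to J, that is, the obstruction to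
    J-invariance. *)
Let B X Y : 'M[F]_d := Q X Y - Q (J *m X) (J *m Y).

(* J times Bianchi at (X, Y, J Z) and (J X, J Y, J Z), combined with Bianchi at
   (J X, Y, J Z) and (X, J Y, J Z): all terms not acting on Z cancel. *)
Let PE X Y (Z : 'cV[F]_d) : (B X Y + J *m B (J *m X) Y) *m Z = 0.
Proof.
have b X' Y' (Z' : 'cV[F]_d) : Q X' Y' *m Z' + Q Y' Z' *m X' + Q Z' X' *m Y' = 0
  := bicontract_bianchi X' Y' Z' Tbianchi.
have b' X' Y' (Z' : 'cV[F]_d) : J *m (Q X' Y' *m Z') + J *m (Q Y' Z' *m X')
    + J *m (Q Z' X' *m Y') = 0 by rewrite -!mulmxDr b mulmx0.
move: (b' X Y (J *m Z)) (b' (J *m X) (J *m Y) (J *m Z)).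
move: (b (J *m X) Y (J *m Z)) (b X (J *m Y) (J *m Z)).
have -> : (B X Y + J *m B (J *m X) Y) *m Z =
    Q X Y *m Z - Q (J *m X) (J *m Y) *m Z
    + (J *m (Q (J *m X) Y *m Z) + J *m (Q X (J *m Y) *m Z)).
  by rewrite /B JJE QNl opprK mulmxDl mulmxBl -mulmxA mulmxDl mulmxDr.
rewrite !QJ !JJE ?QNl ?QNr ?mulNmx ?mulmxN.
(* The products carrying a factor J are abstracted first because they contain the others. What
   remains is linear arithmetic in four vector relations. *)
do ?match goal with |- context [?t] =>
  lazymatch t with J *m (Q _ _ *m _) => generalize t; intro end end.
do ?match goal with |- context [?t] =>
  lazymatch t with Q _ _ *m _ => generalize t; intro end end.
move=> e1 e2 e3 e4; apply/colP => a.
have {}e1 := congr1 (fun v : 'cV[F]_d => v a 0) e1.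
have {}e2 := congr1 (fun v : 'cV[F]_d => v a 0) e2.
have {}e3 := congr1 (fun v : 'cV[F]_d => v a 0) e3.
have {}e4 := congr1 (fun v : 'cV[F]_d => v a 0) e4.
by rewrite !mxE in e1 e2 e3 e4 *; lra.
Qed.

(** [PE] gives B(X, Y) + J B(JX, Y) = 0. The values of B commute with I while J anticommutes with
    it, so moving I from one side of this sum to the other flips the sign of the second term only.
    Hence both terms vanish. *)
Let B0 X Y : B X Y = 0.
Proof.
have P0 X' Y' : B X' Y' + J *m B (J *m X') Y' = 0.
  apply/matrixP => a b; rewrite -[0 in RHS](mulmx0 _ (B X' Y' + J *m B (J *m X') Y')).
  have /(congr1 (fun v : 'cV[F]_d => v a 0)) := PE X' Y' (delta_mx b 0).
  by rewrite -colE mulmx0 !mxE.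
have BI X' Y' : B X' Y' *m I = I *m B X' Y'.
  by rewrite /B mulmxBl mulmxBr /Q !(@bicontract_comm _ _ _ I).
have JB : J *m B (J *m X) Y = 0.
  have IP : I *m (B X Y + J *m B (J *m X) Y) = (B X Y + J *m B (J *m X) Y) *m I.
    by rewrite P0 mulmx0 mul0mx.
  have IPE : I *m (B X Y + J *m B (J *m X) Y) =
      I *m B X Y + I *m (J *m B (J *m X) Y) by rewrite mulmxDr.
  have PIE : (B X Y + J *m B (J *m X) Y) *m I =
      I *m B X Y - I *m (J *m B (J *m X) Y).
    by rewrite mulmxDl -mulmxA !BI (mulmxA J) IJ mulNmx -mulmxA.
  have IJB : I *m (J *m B (J *m X) Y) = 0.
    by apply: eq_opp_eq0; apply: (addrI (I *m B X Y)); rewrite -IPE -PIE.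
  by apply: oppr_inj; rewrite -IIE IJB mulmx0 oppr0.
by have := P0 X Y; rewrite JB addr0.
Qed.

(** [J *m W *m J^T] is the push-forward of W by J, so this is [B0] extended linearly from the
    rank-one case. *)
Lemma bicontract_conj (W : 'M[F]_d) : bicontract T (J *m W *m J^T) = bicontract T W.
Proof.
rewrite (matrix_sum_delta W) mulmx_sumr mulmx_suml !linear_sum.
apply: eq_bigr => b _; rewrite mulmx_sumr mulmx_suml !linear_sum.
apply: eq_bigr => c _; rewrite -scalemxAr -scalemxAl !linearZ /=.
set u : 'cV[F]_d := delta_mx b 0; set v : 'cV[F]_d := delta_mx c 0.
have -> : delta_mx b c = u *m v^T by rewrite trmx_delta mul_delta_mx.
have -> : J *m (u *m v^T) *m J^T = J *m u *m (J *m v)^T.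
  by rewrite trmx_mul !mulmxA.
by congr (_ *: _); apply/esym/eqP; rewrite -subr_eq0; exact/eqP/B0.
Qed.

(** The first contraction pairs a symmetric H with an alternating T. For the second, conjugation by
    J turns I H into - I H, since J I = - I J, yet it preserves the contraction. *)
Lemma bicontract_invariant (H : 'M[F]_d) : H^T = H -> J *m H *m J^T = H ->
  bicontract T H = 0 /\ bicontract T (I *m H) = 0.
Proof.
move=> Hs HJ; split; apply: eq_opp_eq0; first by rewrite -[in RHS]bicontract_tr ?Hs.
rewrite -[LHS]bicontract_conj -linearN /=; congr (bicontract _ _).
by rewrite mulmxA IJ mulNmx mulNmx -!mulmxA (mulmxA J) HJ.
Qed.

End JInvariance.

(** * Pair symmetry of a metric curvature tensor *)

Section PairSymmetry.
Variables (F : realFieldType) (d : nat) (T : 'I_d -> 'I_d -> 'M[F]_d).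
Variables (G : 'M[F]_d).
Hypotheses (Tanti : forall b c, T b c = - T c b)
  (Tbianchi : forall a b c e, T b c a e + T c e a b + T e b a c = 0)
  (TG : forall b c, (T b c)^T *m G + G *m T b c = 0) (Gs : G^T = G).

(** The classical argument for Riemannian curvature: [TG] makes the lowered tensor skew in its last
    pair, and four Bianchi identities combined with skewness in both pairs yield the exchange. *)
Lemma pair_symmetry b c e f : (G *m T b c) e f = (G *m T e f) b c.
Proof.
have anti1 b' c' e' f' : (G *m T b' c') e' f' = - (G *m T c' b') e' f'.
  by rewrite Tanti mulmxN mxE.
have anti2 b' c' e' f' : (G *m T b' c') e' f' = - (G *m T b' c') f' e'.
  have /matrixP/(_ e' f') := TG b' c'; rewrite -[in X in X + _]Gs -trmx_mul.
  by rewrite mxE [X in X + _]mxE [RHS]mxE => /eqP; rewrite addrC addr_eq0 => /eqP.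
have bianchi b' c' e' f' : (G *m T b' c') f' e' + (G *m T c' e') f' b'
    + (G *m T e' b') f' c' = 0.
  rewrite !mxE -!big_split big1// => a _ /=.
  by rewrite -!mulrDr Tbianchi mulr0.
have := bianchi b c e f; have := bianchi c e f b.
have := bianchi e f b c; have := bianchi f b c e.
have := anti2 b c f e; have := anti2 c e f b; have := anti2 e f c b.
have := anti2 f b c e; have := anti1 e b f c; have := anti2 b e f c.
have := anti1 f c b e; have := anti2 c f b e.
by lra.
Qed.

End PairSymmetry.

(** * Quaternionic algebra of the covariant derivative of a metric *)

Section ParallelMetric.
Variables (F : realFieldType) (d : nat) (N : 'I_d -> 'M[F]_d).
Variables (I J : 'M[F]_d).
Hypotheses (NI : forall a, I^T *m N a *m I = N a)
  (NJ : forall a, J^T *m N a *m J = N a)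
  (II : I *m I = - 1%:M) (JJ : J *m J = - 1%:M) (IJ : J *m I = - (I *m J))
  (cycJ : forall a b c,
    (J^T *m N a) b c + (J^T *m N b) c a + (J^T *m N c) a b = 0)
  (cycK : forall a b c, ((I *m J)^T *m N a) b c + ((I *m J)^T *m N b) c a
    + ((I *m J)^T *m N c) a b = 0).

(** [N a] models nabla_a g, while [cycJ] and [cycK] model closedness of the forms of J and of K = I
    J. Together they give N(X) = I^T N(IX). Conjugation by J fixes the left side by [NJ], but
    negates the right side because J anticommutes with I. *)
Lemma quaternionic_cyclic_eq0 a : N a = 0.
Proof.
(* [M e] is N in the direction I d_e. *)
pose M e := \sum_f I f e *: N f.
have NIr f : N f *m I = - (I^T *m N f).
  rewrite -[in RHS](NI f) !mulmxA -trmx_mul II linearN /= trmx1.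
  by rewrite mulNmx mul1mx mulNmx opprK.
(* [cycK] at (I X, Y, Z) minus [cycJ] at (X, Y, Z). *)
have KM e : (I *m J)^T *m M e = J^T *m N e.
  apply/matrixP => b c; apply/eqP; rewrite -subr_eq0; apply/eqP.
  have <- : \sum_f I f e * (((I *m J)^T *m N f) b c + ((I *m J)^T *m N b) c f
    + ((I *m J)^T *m N c) f b) = 0 by rewrite big1// => f _; rewrite cycK mulr0.
  have e1 : ((I *m J)^T *m M e) b c = \sum_f I f e * ((I *m J)^T *m N f) b c.
    rewrite mulmx_sumr summxE; apply: eq_bigr => f _.
    by rewrite -scalemxAr mxE.
  (* The last two terms of the two cyclic identities agree, because I (I J) = - J; only the first
     terms survive the subtraction. *)
  have e2 : (J^T *m N b) c e = \sum_f I f e * ((I *m J)^T *m N b) c f.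
    transitivity ((((I *m J)^T *m N b *m I)) c e).
      rewrite -mulmxA NIr mulmxN mulmxA -trmx_mul mulmxA II.
      by rewrite mulNmx mul1mx linearN mulNmx opprK.
    by rewrite mxE; apply: eq_bigr => f _; rewrite mulrC.
  have e3 : (J^T *m N c) e b = \sum_f I f e * ((I *m J)^T *m N c) f b.
    transitivity (((I^T *m ((I *m J)^T *m N c))) e b).
      rewrite mulmxA -trmx_mul -mulmxA IJ mulmxN mulmxA II.
      by rewrite mulNmx mul1mx opprK.
    by rewrite mxE; apply: eq_bigr => f _; rewrite mxE.
  under [RHS]eq_bigr do rewrite !mulrDr.
  rewrite !big_split /= -e1 -e2 -e3.
  by have := cycJ e b c; lra.
have JTJ (A : 'M[F]_d) : J^T *m (J^T *m A) = - A.
  by rewrite mulmxA -trmx_mul JJ linearN /= trmx1 mulNmx mul1mx.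
have IM e : I^T *m M e = N e.
  by apply: oppr_inj; rewrite -!JTJ -KM trmx_mul !mulmxA.
have MJ e : J^T *m M e *m J = M e.
  rewrite mulmx_sumr mulmx_suml; apply: eq_bigr => f _.
  by rewrite -scalemxAr -scalemxAl NJ.
apply: eq_opp_eq0; rewrite -{1}NJ -IM !mulmxA -trmx_mul -[I *m J]opprK -IJ.
rewrite linearN /= trmx_mul.
by rewrite !mulNmx -!mulmxA [J^T *m _]mulmxA MJ.
Qed.

End ParallelMetric.

(** Both sides contract the lowered tensor with V in one index pair and W in the other. This trades
    a trace over the last pair for one over the first. *)
Lemma bicontract_tr_pair (F : comNzRingType) d (T : 'I_d -> 'I_d -> 'M[F]_d)
    (G V W : 'M[F]_d) :
  (forall b c e f, (G *m T b c) e f = (G *m T e f) b c) ->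
  \tr (W^T *m (G *m bicontract T V)) = \tr (V^T *m (G *m bicontract T W)).
Proof.
move=> TG.
have E A B : \tr (A^T *m (G *m bicontract T B)) =
    \sum_e \sum_f \sum_b \sum_c A e f * B b c * (G *m T b c) e f.
  rewrite /mxtrace exchange_big; apply: eq_bigr => f _; rewrite mxE.
  apply: eq_bigr => e _; rewrite mxE mulmx_sumr summxE mulr_sumr.
  apply: eq_bigr => b _; rewrite mulmx_sumr summxE mulr_sumr.
  by apply: eq_bigr => c _; rewrite -scalemxAr mxE mulrA.
rewrite !E; under eq_bigr do rewrite exchange_big.
under eq_bigr do under eq_bigr do rewrite exchange_big.
rewrite exchange_big; apply: eq_bigr => e _.
rewrite exchange_big; apply: eq_bigr => f _.
apply: eq_bigr => b _; apply: eq_bigr => c _.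
by rewrite TG (mulrC (W _ _)).
Qed.

#[local] Arguments cframe {R N} s : simpl never.
#[local] Arguments ccoframe {R N} s : simpl never.

(** * Type decomposition in the complex frame of a holomorphic chart *)

Section Frame.
Variables (R : realType) (N : nat).
Local Notation C := R[i].
Local Notation d := (N + N)%N.
Local Notation i := ('i%C : C).
Implicit Types (A G H : 'M[R]_d).

Lemma ccoframe_dual s t : (@ccoframe R N s *m cframe t) 0 0 = (s == t)%:R.
Proof.
have dl (a b : 'I_N) : (lshift N a == lshift N b) = (a == b).
  exact: (inj_eq (@lshift_inj _ _)).
have dr (a b : 'I_N) : (rshift N a == rshift N b) = (a == b).
  exact: (inj_eq (@rshift_inj _ _)).
have i2 : i * i = -1 by rewrite -expr2 sqr_i.
have h2 : (2 : C) != 0 by rewrite pnatr_eq0.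
case: s t => r [] t; rewrite /= ?mulmxBl ?mulmxDl -?scalemxAl -!rowE !mxE;
  rewrite ?eqxx ?eq_lrshift ?eq_rlshift ?dl ?dr /= ?andbT;
  rewrite /eq_op /= (inj_eq (@ord_inj _)); case: (r == t) => /=;
  rewrite ?mulr0n ?mulr1n ?(mulr0, subr0, addr0, add0r, mulr1, sub0r, oppr0)//;
  by rewrite (mulrCA i) ?mulrN i2; field.
Qed.

Lemma toC_mul m n p (A : 'M[R]_(m, n)) (B : 'M[R]_(n, p)) :
  toC (A *m B) = toC A *m toC B.
Proof. exact: map_mxM. Qed.

Lemma toC_tr m n (A : 'M[R]_(m, n)) : toC A^T = (toC A)^T.
Proof. by rewrite /toC map_trmx. Qed.

Let conjci : conjc i = - i.
Proof. by apply/eqP; rewrite eq_complex /= oppr0 !eqxx. Qed.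

Lemma ccoframe_conj r :
  @ccoframe R N (inr r) = map_mx (@conjc R) (ccoframe (inl r)).
Proof.
apply/rowP => a; rewrite !mxE rmorphD rmorphM !rmorph_nat.
by rewrite -mulNr; congr (_ + _ * _); exact/esym/conjci.
Qed.

Variable I : 'M[R]_d.
Hypothesis hol : forall r, ccoframe (inl r) *m toC I = i *: ccoframe (inl r).

Let holbar r : ccoframe (inr r) *m toC I = - i *: ccoframe (inr r).
Proof.
have conjI : map_mx (@conjc R) (toC I) = toC I.
  by apply/matrixP => a b; rewrite !mxE conjc_real.
rewrite ccoframe_conj -[X in _ *m X]conjI -map_mxM hol map_mxZ.
by congr (_ *: _); exact: conjci.
Qed.

Let I_frame r : toC I *m cframe (inl r) = i *: cframe (inl r).
Proof.
rewrite [LHS]cframe_decomp [cframe (inl r) in RHS]cframe_decomp scaler_sumr.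
apply: eq_bigr => s _; rewrite scalerA; congr (_ *: _); rewrite mulmxA.
case: s => s; rewrite ?hol ?holbar -scalemxAl mxE // !ccoframe_dual.
by rewrite !mulr0.
Qed.

Definition proj10 : 'M[C]_d := \sum_r cframe (inl r) *m ccoframe (inl r).
Definition proj01 : 'M[C]_d := \sum_r cframe (inr r) *m ccoframe (inr r).

Lemma proj_sum : proj10 + proj01 = 1%:M.
Proof.
apply/matrixP => a b.
transitivity ((delta_mx b 0 : 'cV[C]_d) a 0); last by rewrite !mxE eqxx andbT.
rewrite (cframe_decomp (delta_mx b 0)) summxE big_sumType.
rewrite mxE !summxE; congr (_ + _).
- apply: eq_bigr => r _.
  by rewrite -colE [LHS]mxE big_ord1 [RHS]mxE mulrC [X in _ = X * _]mxE.
- apply: eq_bigr => r _.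
  by rewrite -colE [LHS]mxE big_ord1 [RHS]mxE mulrC [X in _ = X * _]mxE.
Qed.

(** The projectors P and P' satisfy P I = i P, P' I = - i P' and P + P' = 1. Hence I = i P - i P',
    which is solved for P. *)
Lemma proj10E : proj10 = 2^-1 *: (1%:M - i *: toC I).
Proof.
have i2 : i * i = -1 by rewrite -expr2 sqr_i.
have h2 : (2 : C) != 0 by rewrite pnatr_eq0.
have e1 : proj10 *m toC I = i *: proj10.
  rewrite mulmx_suml scaler_sumr; apply: eq_bigr => r _.
  by rewrite -mulmxA hol scalemxAr.
have e2 : proj01 *m toC I = - i *: proj01.
  rewrite mulmx_suml scaler_sumr; apply: eq_bigr => r _.
  by rewrite -mulmxA holbar scalemxAr.
have e3 : toC I = i *: proj10 - i *: proj01.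
  by rewrite -scaleNr -e1 -e2 -mulmxDl proj_sum mul1mx.
rewrite e3 [i *: (_ - _)]scalerBr !(scalerA i) i2 !scaleN1r opprK opprD opprK.
rewrite -proj_sum addrACA subrr addr0 -mulr2n -(scaler_nat 2 proj10).
by rewrite scalerA mulVf// scale1r.
Qed.

Let trZ m n (k : C) (A : 'M[C]_(m, n)) : (k *: A)^T = k *: A^T.
Proof. exact: linearZ. Qed.

(** Applying I to both (1,0)-vectors leaves the value unchanged and also multiplies it by i^2 =
    -1. *)
Lemma frame_isotropic G (r l : 'I_N) : I^T *m G *m I = G ->
  (cframe (inl r))^T *m toC G *m cframe (inl l) = 0 :> 'M[C]_1.
Proof.
have i2 : i * i = -1 by rewrite -expr2 sqr_i.
move=> GI; apply: eq_opp_eq0; rewrite -[in LHS]GI !toC_mul toC_tr.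
have -> (A : 'M[C]_d) (u v : 'cV[C]_d) : u^T *m ((toC I)^T *m A *m toC I) *m v =
    (toC I *m u)^T *m A *m (toC I *m v) by rewrite trmx_mul !mulmxA.
move: (I_frame r) (I_frame l); move: (cframe (inl r)) (cframe (inl l)) => u v.
by move=> -> ->; rewrite trZ -!scalemxAl -scalemxAr scalerA i2 scaleN1r.
Qed.

Lemma coframe_isotropic H (r l : 'I_N) : I *m H *m I^T = H ->
  ccoframe (inl r) *m toC H *m (ccoframe (inl l))^T = 0 :> 'M[C]_1.
Proof.
have i2 : i * i = -1 by rewrite -expr2 sqr_i.
move=> HI; apply: eq_opp_eq0; rewrite -[in LHS]HI.
rewrite !toC_mul toC_tr !mulmxA hol -!mulmxA -trmx_mul hol.
by rewrite trZ -!scalemxAr -!scalemxAl scalerA i2 scaleN1r !mulmxA.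
Qed.

Let mul11E (x y : 'M[C]_1) : (x *m y) 0 0 = x 0 0 * y 0 0.
Proof. by rewrite mxE big_ord1. Qed.

Variables G H : 'M[R]_d.
Hypotheses (GI : I^T *m G *m I = G) (HI : I *m H *m I^T = H)
  (Hs : H^T = H) (GH : G *m H = 1%:M).

Definition mixed_gram : 'M[C]_N :=
  \matrix_(k, j) cbilin G (cframe (inl k)) (cframe (inr j)).

(** G has no entries on pairs of (1,0)-vectors, so inserting [proj01] between G and H in G H = 1
    loses nothing. The mixed block of H is thus a right inverse of that of G, hence its inverse. *)
Lemma invmx_mixed_gram : invmx mixed_gram =
  \matrix_(j, k) (ccoframe (inr j) *m toC H *m (ccoframe (inl k))^T) 0 0.
Proof.
set h' := RHS; suff hh : mixed_gram *m h' = 1%:M.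
  have [hu _] := mulmx1_unit hh.
  by rewrite -[LHS]mulmx1 -hh mulmxA mulVmx// mul1mx.
apply/matrixP => k l; rewrite mxE.
transitivity (((cframe (inl k))^T *m toC G *m proj01 *m toC H
    *m (ccoframe (inl l))^T) 0 0).
  rewrite mulmx_sumr !mulmx_suml summxE; apply: eq_bigr => j _.
  by rewrite [mixed_gram k j]mxE [h' j l]mxE -mul11E !mulmxA.
have -> : proj01 = 1%:M - proj10 by rewrite -proj_sum addrAC subrr add0r.
rewrite mulmxBr mulmx1 !mulmxBl -[_ *m toC G *m toC H]mulmxA -toC_mul GH.
rewrite [toC 1%:M]map_mx1 mulmx1 mxE -trmx_mul mxE ccoframe_dual.
rewrite [X in _ + X]mxE mulmx_sumr !mulmx_suml summxE big1 ?subr0; last first.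
  by move=> j _; rewrite mulmxA frame_isotropic// !mul0mx mxE.
by rewrite mxE eq_sym.
Qed.

(* With G = (g_ab), [invmx mixed_gram j k] is g^{k \bar j}. *)
Lemma inverse_metric_mixed_part :
  \sum_k \sum_j invmx mixed_gram j k *: (cframe (inl k) *m (cframe (inr j))^T)
  = proj10 *m toC H.
Proof.
have regroup k r (a b : 'cV[C]_d) : a *m ccoframe k *m toC H *m (b *m ccoframe r)^T
    = (ccoframe k *m toC H *m (ccoframe r)^T) 0 0 *: (a *m b^T).
  have -> : a *m ccoframe k *m toC H *m (b *m ccoframe r)^T =
      a *m (ccoframe k *m toC H *m (ccoframe r)^T) *m b^T.
    by rewrite trmx_mul !mulmxA.
  by rewrite [X in a *m X]mx11_scalar mul_mx_scalar -scalemxAl.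
transitivity (proj10 *m toC H *m proj01^T).
  rewrite !mulmx_suml; apply: eq_bigr => k _.
  rewrite linear_sum mulmx_sumr; apply: eq_bigr => j _.
  rewrite regroup invmx_mixed_gram mxE; congr (_ *: _).
  have tr11 (x : 'M[C]_1) : x 0 0 = x^T 0 0 by rewrite mxE.
  by rewrite [RHS]tr11 !trmx_mul trmxK -toC_tr Hs mulmxA.
(* Replacing [proj01^T] by the identity costs only entries of H on two (1,0)-covectors, and these
   vanish by [coframe_isotropic]. *)
have -> : proj01 = 1%:M - proj10 by rewrite -proj_sum addrAC subrr add0r.
rewrite linearB /= trmx1 mulmxBr mulmx1 -[RHS]subr0; congr (_ - _).
rewrite !mulmx_suml big1// => k _; rewrite linear_sum mulmx_sumr big1// => j _.
by rewrite regroup coframe_isotropic// mxE scale0r.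
Qed.

(** * Curvature traces in the complex frame *)

Variable T : 'I_d -> 'I_d -> 'M[R]_d.
Local Notation TC := (fun b c => toC (T b c)).
Hypotheses (T_H : bicontract T H = 0) (T_IH : bicontract T (I *m H) = 0).
Hypothesis Tanti : forall b c, T b c = - T c b.

Let TCanti b c : TC b c = - TC c b.
Proof. by rewrite /= [in LHS]Tanti /toC map_mxN. Qed.

Let bicontractC (A : 'M[R]_d) : bicontract TC (toC A) = toC (bicontract T A).
Proof.
rewrite /bicontract /toC raddf_sum; apply: eq_bigr => b _.
rewrite raddf_sum; apply: eq_bigr => c _.
by rewrite /= map_mxZ mxE.
Qed.

Let W := \sum_k \sum_j
  invmx mixed_gram j k *: (cframe (inl k) *m (cframe (inr j))^T).

Let TW : bicontract TC W = 0.
Proof.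
rewrite /W inverse_metric_mixed_part proj10E -scalemxAl mulmxBl mul1mx.
rewrite -scalemxAl -toC_mul linearZ /=.
rewrite linearB /= bicontractC T_H.
rewrite linearZ /= bicontractC T_IH /toC !map_mx0.
by rewrite scaler0 subr0 scaler0.
Qed.

Let tr_rank1 (u v : 'cV[C]_d) (A : 'M[C]_d) :
  (u^T *m A *m v) 0 0 = \tr ((u *m v^T)^T *m A).
Proof.
by rewrite trmx_mul trmxK -[in RHS]mulmxA mxtrace_mulC /mxtrace big_ord1.
Qed.

(** The barred vector is the first argument of the curvature, so the sum contracts T with [W^T];
    skewness turns this into minus the contraction with [W], which is zero by [TW]. *)
Lemma sum_curvature_eq0 (theta : 'rV[C]_d) (v : 'cV[C]_d) :
  \sum_k \sum_j invmx mixed_gram j k *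
    (theta *m (bicontract TC (cframe (inr j) *m (cframe (inl k))^T) *m v)) 0 0
  = 0.
Proof.
transitivity ((theta *m (bicontract TC W^T *m v)) 0 0); last first.
  by rewrite (bicontract_tr _ TCanti) TW oppr0 mul0mx mulmx0 mxE.
rewrite /W linear_sum /= linear_sum mulmx_suml mulmx_sumr summxE.
apply: eq_bigr => k _; rewrite linear_sum linear_sum mulmx_suml mulmx_sumr summxE.
apply: eq_bigr => j _.
move: (cframe (inl k)) (cframe (inr j)) => e f /=.
by rewrite trZ trmx_mul trmxK linearZ /= -scalemxAl -scalemxAr [RHS]mxE.
Qed.

(** The sum is the trace of W^T G' T(V), where V is the bivector of the fixed indices s and r. Pair
    symmetry exchanges V and W, and the contraction with W is zero. *)
Lemma sum_lowered_curvature_eq0 (G' : 'M[R]_d) (r s : 'I_N) :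
  I^T *m G' *m I = G' ->
  (forall b c e f, (G' *m T b c) e f = (G' *m T e f) b c) ->
  \sum_k \sum_j \sum_l invmx mixed_gram j k *
    cbilin G' (cframe (inl k)) (cframe (inr l)) *
    (ccoframe (inr l) *m
      (bicontract TC (cframe (inr s) *m (cframe (inl r))^T) *m cframe (inr j))) 0 0
  = 0.
Proof.
move=> G'I G'T; set V := _ *m (cframe (inl r))^T.
have TCpair b c e f : (toC G' *m TC b c) e f = (toC G' *m TC e f) b c.
  by rewrite -!toC_mul [LHS]mxE [RHS]mxE G'T.
transitivity (\tr (W^T *m (toC G' *m bicontract TC V))); last first.
  by rewrite (bicontract_tr_pair _ _ TCpair) TW mulmx0 mulmx0 mxtrace0.
rewrite /W linear_sum mulmx_suml linear_sum; apply: eq_bigr => k _.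
rewrite linear_sum mulmx_suml linear_sum; apply: eq_bigr => j _ /=.
transitivity (invmx mixed_gram j k *
   ((cframe (inl k))^T *m (toC G' *m bicontract TC V) *m cframe (inr j)) 0 0);
  last first.
  move: (cframe (inl k)) (cframe (inr j)) => e f.
  by rewrite tr_rank1 trZ -scalemxAl linearZ.
under eq_bigr do rewrite -mulrA; rewrite -mulr_sumr; congr (_ * _).
(* The sum over l inserts [proj01]. It may be replaced by the identity, since G' pairs two
   (1,0)-vectors to zero. *)
transitivity (((cframe (inl k))^T *m toC G' *m proj01 *m
   (bicontract TC V *m cframe (inr j))) 0 0).
  rewrite mulmx_sumr mulmx_suml summxE; apply: eq_bigr => l _.
  by rewrite /cbilin -mul11E !mulmxA.
have -> : proj01 = 1%:M - proj10 by rewrite -proj_sum addrAC subrr add0r.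
rewrite mulmxBr mulmx1 mulmxBl mxE -[RHS]addr0 !mulmxA; congr (_ + _).
have -> : (cframe (inl k))^T *m toC G' *m proj10 = 0.
  rewrite mulmx_sumr big1// => l _.
  by rewrite mulmxA frame_isotropic// mul0mx.
by rewrite !mul0mx oppr0 mxE.
Qed.

End Frame.

(** * Partial derivatives of smooth functions *)

Section Partials.
Variables (R : realType) (d : nat).
Implicit Types (U : set 'cV[R]_d) (x : 'cV[R]_d) (f g : 'cV[R]_d -> R).

Lemma smooth_derivable U f x i :
  smooth U f -> U x -> derivable f x (delta_mx i 0).
Proof. by move=> /(_ 1%N) [_ /(_ i)[fd _]]; exact: fd. Qed.

Lemma smooth_continuous U f x : smooth U f -> U x -> {for x, continuous f}.
Proof. by move=> /(_ 0%N) [fc _]; exact: fc. Qed.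

Lemma smooth_partial U f i : smooth U f -> smooth U (partial i f).
Proof. by move=> sf k; have [_ /(_ i)[]] := sf k.+1. Qed.

Lemma partial_cst (i : 'I_d) (k : R) : partial i (fun=> k) = fun=> 0.
Proof. by apply/funext => x; exact: derive_cst. Qed.

Lemma smooth_cst U (k : R) : smooth U (fun=> k).
Proof.
move=> n; elim: n k => [|n IH] k.
  by split=> // x _; exact: cst_continuous.
split=> [x _|i]; first exact: cst_continuous.
by rewrite partial_cst; split=> // x _; exact: derivable_cst.
Qed.

Lemma partial_comm U f x i j : open U -> smooth U f -> U x ->
  partial i (partial j f) x = partial j (partial i f) x.
Proof.
move=> Uo sf Ux; apply: (schwarz_derive Uo Ux).
- by move=> y Uy; split; apply: smooth_derivable sf Uy.
- by move=> y Uy; split; apply: smooth_derivable Uy; exact: smooth_partial.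
- by apply: (@smooth_continuous U) => //; do 2!apply: smooth_partial.
- by apply: (@smooth_continuous U) => //; do 2!apply: smooth_partial.
Qed.

Lemma eq_partial U f g x i : open U -> U x -> (forall y, U y -> f y = g y) ->
  partial i f x = partial i g x.
Proof.
move=> Uo Ux fg; apply: near_eq_derive.
by apply: filterS fg _; exact: open_nbhs_nbhs.
Qed.

End Partials.

(** * Differentiation of matrix-valued functions *)

Section MatrixCalculus.
Variables (R : realType) (d : nat).
Implicit Types (U : set 'cV[R]_d) (x : 'cV[R]_d).

Definition partial_mx m n (i : 'I_d) (A : 'cV[R]_d -> 'M[R]_(m, n)) x : 'M[R]_(m, n) :=
  \matrix_(a, b) partial i (fun y => A y a b) x.

Definition smooth_mx m n U (A : 'cV[R]_d -> 'M[R]_(m, n)) :=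
  forall a b, smooth U (fun y => A y a b).

Definition entrywise_derivable m n (A : 'cV[R]_d -> 'M[R]_(m, n)) x i :=
  forall a b, derivable (fun y => A y a b) x (delta_mx i 0).

Lemma eq_dmx m n U (A B : 'cV[R]_d -> 'M[R]_(m, n)) x i : open U -> U x ->
  (forall y, U y -> A y = B y) -> partial_mx i A x = partial_mx i B x.
Proof.
move=> Uo Ux AB; apply/matrixP => a b; rewrite !mxE.
by apply: (eq_partial _ Uo Ux) => y Uy; rewrite AB.
Qed.

Lemma partial_mx_comm m n U (A : 'cV[R]_d -> 'M[R]_(m, n)) x i j : open U -> U x ->
  smooth_mx U A -> partial_mx i (partial_mx j A) x = partial_mx j (partial_mx i A) x.
Proof.
move=> Uo Ux sA; apply/matrixP => a b; rewrite [LHS]mxE [RHS]mxE.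
transitivity (partial i (partial j (fun y => A y a b)) x).
  by congr (partial _ _ _); apply/funext => y; rewrite mxE.
rewrite (partial_comm _ _ Uo (sA a b) Ux).
by congr (partial _ _ _); apply/funext => y; rewrite mxE.
Qed.

Lemma smooth_mx_derivable m n U (A : 'cV[R]_d -> 'M[R]_(m, n)) x i :
  smooth_mx U A -> U x -> entrywise_derivable A x i.
Proof. by move=> sA Ux a b; apply: smooth_derivable (sA a b) Ux. Qed.

Lemma derivable_trmx m n (A : 'cV[R]_d -> 'M[R]_(m, n)) x i :
  entrywise_derivable A x i -> entrywise_derivable (fun y => (A y)^T) x i.
Proof.
move=> dA a b; have -> : (fun y => (A y)^T a b) = (fun y => A y b a).
  by apply/funext => y; rewrite mxE.
exact: dA.
Qed.

Lemma partial_mx_tr m n (A : 'cV[R]_d -> 'M[R]_(m, n)) x i :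
  partial_mx i (fun y => (A y)^T) x = (partial_mx i A x)^T.
Proof.
apply/matrixP => a b; rewrite !mxE; congr partial.
by apply/funext => y; rewrite mxE.
Qed.

Lemma partial_mxD m n (A B : 'cV[R]_d -> 'M[R]_(m, n)) x i :
  entrywise_derivable A x i -> entrywise_derivable B x i ->
  partial_mx i (fun y => A y + B y) x = partial_mx i A x + partial_mx i B x.
Proof.
move=> dA dB; apply/matrixP => a b; rewrite !mxE.
have -> : (fun y => (A y + B y) a b) = (fun y => A y a b) + (fun y => B y a b).
  by apply/funext => y; rewrite mxE.
exact: deriveD.
Qed.

Lemma partial_mxB m n (A B : 'cV[R]_d -> 'M[R]_(m, n)) x i :
  entrywise_derivable A x i -> entrywise_derivable B x i ->
  partial_mx i (fun y => A y - B y) x = partial_mx i A x - partial_mx i B x.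
Proof.
move=> dA dB; apply/matrixP => a b; rewrite !mxE.
have -> : (fun y => (A y - B y) a b) = (fun y => A y a b) - (fun y => B y a b).
  by apply/funext => y; rewrite !mxE.
exact: deriveB.
Qed.

Lemma mulmx_entry_fun m n p (A : 'cV[R]_d -> 'M[R]_(m, n))
    (B : 'cV[R]_d -> 'M[R]_(n, p)) a b :
  (fun y => (A y *m B y) a b) =
  \sum_(k < n) ((fun y => A y a k) * (fun y => B y k b)).
Proof. by apply/funext => y; rewrite mxE fct_sumE. Qed.

Lemma derivable_mulmx m n p (A : 'cV[R]_d -> 'M[R]_(m, n))
    (B : 'cV[R]_d -> 'M[R]_(n, p)) x i :
  entrywise_derivable A x i -> entrywise_derivable B x i ->
  entrywise_derivable (fun y => A y *m B y) x i.
Proof.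
move=> dA dB a b; rewrite mulmx_entry_fun.
by apply: derivable_sum => k; exact: derivableM.
Qed.

Lemma partial_mxM m n p (A : 'cV[R]_d -> 'M[R]_(m, n))
    (B : 'cV[R]_d -> 'M[R]_(n, p)) x i :
  entrywise_derivable A x i -> entrywise_derivable B x i ->
  partial_mx i (fun y => A y *m B y) x =
    partial_mx i A x *m B x + A x *m partial_mx i B x.
Proof.
move=> dA dB; apply/matrixP => a b; rewrite !mxE mulmx_entry_fun.
rewrite /partial derive_sum => [|k]; last exact: derivableM.
rewrite -big_split; apply: eq_bigr => k _ /=.
rewrite deriveM// [partial_mx i A x a k]mxE [partial_mx i B x k b]mxE addrC.
by congr (_ + _); exact: mulrC.
Qed.

Lemma partial_mx_cst m n (A : 'M[R]_(m, n)) x i : partial_mx i (fun=> A) x = 0.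
Proof. by apply/matrixP => a b; rewrite [LHS]mxE partial_cst mxE. Qed.

Lemma partial_mxMr m n p (A : 'cV[R]_d -> 'M[R]_(m, n)) (B : 'M[R]_(n, p)) x i :
  entrywise_derivable A x i ->
  partial_mx i (fun y => A y *m B) x = partial_mx i A x *m B.
Proof.
move=> dA; rewrite partial_mxM//.
by rewrite partial_mx_cst mulmx0 addr0.
Qed.

Lemma partial_mx_sum m n p (A : 'I_p -> 'cV[R]_d -> 'M[R]_(m, n)) x i :
  (forall k, entrywise_derivable (A k) x i) ->
  partial_mx i (fun y => \sum_k A k y) x = \sum_k partial_mx i (A k) x.
Proof.
move=> dA; apply/matrixP => a b; rewrite [LHS]mxE summxE.
have -> : (fun y => (\sum_k A k y) a b) = \sum_k (fun y => A k y a b).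
  by apply/funext => y; rewrite summxE fct_sumE.
rewrite /partial derive_sum; last by move=> k; exact: dA.
by apply: eq_bigr => k _; rewrite mxE.
Qed.

End MatrixCalculus.

(** * Connection and curvature in matrix form *)

Section Connection.
Variables (R : realType) (d : nat).
Local Notation C := R[i].
Implicit Types (x : 'cV[R]_d) (G : christoffel_array R d) (X Y Z : cvfield R d).

(** The connection matrix in direction d_b: on columns, nabla_b = d_b + Gamma_b. *)
Definition christoffel_mx G (b : 'I_d) x : 'M[R]_d := \matrix_(a, c) G x a b c.

Definition cpartial_cv (b : 'I_d) Y x : 'cV[C]_d :=
  \col_a cpartial b (fun y => Y y a 0) x.

Lemma covDE G X Y x : covD G X Y x =
  \sum_b X x b 0 *: (cpartial_cv b Y x + toC (christoffel_mx G b x) *m Y x).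
Proof.
apply/colP => a; rewrite mxE summxE /along -big_split; apply: eq_bigr => b _.
rewrite [RHS]mxE [(cpartial_cv _ _ _ + _) a 0]mxE [cpartial_cv _ _ _ a 0]mxE mulrDr.
congr (_ + _); rewrite mxE mulr_sumr; apply: eq_bigr => c _.
by rewrite !mxE mulrCA mulrA.
Qed.

Lemma lieE X Y x :
  lie X Y x = \sum_b (X x b 0 *: cpartial_cv b Y x - Y x b 0 *: cpartial_cv b X x).
Proof.
apply/colP => a; rewrite mxE summxE /along -sumrB; apply: eq_bigr => b _.
rewrite [RHS]mxE [X in _ = _ + X]mxE [X in _ = X - _]mxE [X in _ = _ - X]mxE.
by rewrite [cpartial_cv b Y x a 0]mxE [cpartial_cv b X x a 0]mxE.
Qed.

Lemma cpartial_cst b (k : C) : cpartial b (fun=> k) = fun _ : 'cV[R]_d => 0.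
Proof. by apply/funext => x; rewrite /cpartial !partial_cst. Qed.

Lemma cpartial_cv_cst b (v : 'cV[C]_d) x : cpartial_cv b (fun=> v) x = 0.
Proof. by apply/colP => a; rewrite [LHS]mxE cpartial_cst mxE. Qed.

Lemma Re_toCM m n p (A : 'M[R]_(m, n)) (v : 'M[C]_(n, p)) a b :
  complex.Re ((toC A *m v) a b) = (A *m map_mx (@complex.Re R) v) a b.
Proof.
rewrite !mxE (raddf_sum (@complex.Re R)); apply: eq_bigr => k _; rewrite !mxE /=.
by case: (v k b) => re im /=; rewrite mul0r subr0.
Qed.

Lemma Im_toCM m n p (A : 'M[R]_(m, n)) (v : 'M[C]_(n, p)) a b :
  complex.Im ((toC A *m v) a b) = (A *m map_mx (@complex.Im R) v) a b.
Proof.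
rewrite !mxE raddf_sum; apply: eq_bigr => k _; rewrite !mxE /=.
by case: (v k b) => re im /=; rewrite mul0r addr0.
Qed.

Lemma cpartial_cv_sum_toCM b n m (A : 'I_n -> 'cV[R]_d -> 'M[R]_(d, m))
    (v : 'I_n -> 'cV[C]_m) x : (forall k, entrywise_derivable (A k) x b) ->
  cpartial_cv b (fun y => \sum_k toC (A k y) *m v k) x =
  \sum_k toC (partial_mx b (A k) x) *m v k.
Proof.
move=> dA.
(* Here [p] is the real or the imaginary part; both are additive and commute with real matrices. *)
have part (p : C -> R) (padd : {morph p : u w / u + w}) (p0 : p 0 = 0)
    (pM : forall (B : 'M[R]_(d, m)) (u : 'cV[C]_m) a,
      p ((toC B *m u) a 0) = (B *m map_mx p u) a 0) a :
    partial b (fun y => p ((\sum_k toC (A k y) *m v k) a 0)) x =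
    p ((\sum_k toC (partial_mx b (A k) x) *m v k) a 0).
  have E (B : 'I_n -> 'M[R]_(d, m)) :
      p ((\sum_k toC (B k) *m v k) a 0) = (\sum_k B k *m map_mx p (v k)) a 0.
    rewrite !summxE (big_morph p padd p0).
    by apply: eq_bigr => k _; rewrite pM.
  rewrite E; have -> : (fun y => p ((\sum_k toC (A k y) *m v k) a 0)) =
      (fun y => (\sum_k A k y *m map_mx p (v k)) a 0).
    by apply/funext => y; rewrite E.
  have dAv k : entrywise_derivable (fun y => A k y *m map_mx p (v k)) x b.
    by apply: derivable_mulmx => // i j; exact: derivable_cst.
  have /matrixP/(_ a 0) := partial_mx_sum dAv; rewrite [LHS]mxE => ->.
  rewrite !summxE; apply: eq_bigr => k _.
  by rewrite partial_mxMr.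
apply/colP => a; rewrite [LHS]mxE /cpartial.
rewrite (part (@complex.Re R))//; last by move=> *; exact: Re_toCM.
rewrite (part (@complex.Im R))//; last by move=> *; exact: Im_toCM.
- by case: (_ a 0).
- by case=> ? ? [].
- by case=> ? ? [].
Qed.

(** The components of the curvature 2-form d Gamma + Gamma /\ Gamma. *)
Definition curv_mx G x (b c : 'I_d) : 'M[R]_d :=
  partial_mx b (christoffel_mx G c) x - partial_mx c (christoffel_mx G b) x
  + (christoffel_mx G b x *m christoffel_mx G c x
     - christoffel_mx G c x *m christoffel_mx G b x).

Lemma covD_cst G (u v : 'cV[C]_d) x : covD G (fun=> u) (fun=> v) x =
  \sum_b toC (christoffel_mx G b x) *m (u b 0 *: v).
Proof.
rewrite covDE; apply: eq_bigr => b _.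
by rewrite cpartial_cv_cst add0r scalemxAr.
Qed.

Lemma covD_covD_cst G (u v w : 'cV[C]_d) x :
  (forall b c, entrywise_derivable (christoffel_mx G b) x c) ->
  covD G (fun=> u) (covD G (fun=> v) (fun=> w)) x =
  \sum_b \sum_c (u b 0 * v c 0) *:
    (toC (partial_mx b (christoffel_mx G c) x
          + christoffel_mx G b x *m christoffel_mx G c x) *m w).
Proof.
move=> dG; rewrite covDE; apply: eq_bigr => b _.
(* The inner derivative is written as real matrix functions applied to fixed vectors, the shape
   differentiated by [cpartial_cv_sum_toCM]. *)
have -> : covD G (fun=> v) (fun=> w) =
    fun y => \sum_c toC (christoffel_mx G c y) *m (v c 0 *: w).
  by apply/funext => y; exact: covD_cst.
rewrite cpartial_cv_sum_toCM// mulmx_sumr -big_split scaler_sumr.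
apply: eq_bigr => c _ /=; rewrite -scalemxAr -scalemxAr -scalemxAr -scalerDr.
by rewrite scalerA /toC map_mxD map_mxM mulmxDl mulmxA.
Qed.

Lemma curvature_cst G (u v w : 'cV[C]_d) x :
  (forall b c, entrywise_derivable (christoffel_mx G b) x c) ->
  curvature G (fun=> u) (fun=> v) (fun=> w) x =
  bicontract (fun b c => toC (curv_mx G x b c)) (u *m v^T) *m w.
Proof.
move=> dG; rewrite /curvature !covD_covD_cst//.
(* Constant fields commute, so the bracket term of the curvature drops out. *)
have -> : lie (fun=> u) (fun=> v) = fun=> 0.
  apply/funext => y; rewrite lieE big1// => b _.
  by rewrite !cpartial_cv_cst !scaler0 subrr.
rewrite [X in _ - X]covDE [X in _ - X]big1 ?subr0 => [|b _]; last first.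
  by rewrite mxE scale0r.
rewrite [X in _ - X]exchange_big -sumrB mulmx_suml; apply: eq_bigr => b _.
rewrite -sumrB mulmx_suml; apply: eq_bigr => c _.
rewrite mxE big_ord1 mxE -scalemxAl (mulrC (v c 0)) -scalerBr -mulmxBl.
by rewrite /toC -map_mxB opprD addrACA.
Qed.

End Connection.

(* Derives a matrix identity from the antecedents of the goal, linearly in the
   fully expanded matrix products. *)
Ltac mulmx_linear :=
  rewrite ?(mulmxBl, mulmxBr, mulmxDl, mulmxDr, mulNmx, mulmxN, mulmxA);
  repeat match goal with |- context [?t] =>
    lazymatch t with @mulmx _ _ _ _ _ _ => move: t => ? end end;
  repeat (let e := fresh "e" in move=> /matrixP e);
  apply/matrixP; let i := fresh "i" in let j := fresh "j" in move=> i j;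
  repeat match goal with H : eqrel _ _ |- _ => move: (H i j); clear H end;
  rewrite !mxE; lra.

(** * Bianchi and integrability identities in a chart *)

Section LocalGeometry.
Variables (R : realType) (d : nat) (U : set 'cV[R]_d).
Variable G : christoffel_array R d.
Hypotheses (Uo : open U) (sG : forall a i j, smooth U (fun x => G x a i j)).
Local Notation C := R[i].
Local Notation Gam := (christoffel_mx G).

Let dGam x b c : U x -> entrywise_derivable (Gam b) x c.
Proof.
move=> Ux a e; have -> : (fun y => Gam b y a e) = (fun y => G y a b e).
  by apply/funext => y; rewrite mxE.
exact: smooth_derivable (sG a b e) Ux.
Qed.

Lemma smooth_cvfield_cst (v : 'cV[C]_d) : smooth_cvfield U (fun=> v).
Proof. by move=> a; split; exact: smooth_cst. Qed.

Lemma eq_mulmx_delta (F : pzSemiRingType) m n (A B : 'M[F]_(m, n)) :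
  (forall c, A *m (delta_mx c 0 : 'cV_n) = B *m delta_mx c 0) -> A = B.
Proof.
move=> AB; apply/matrixP => a c; have /colP/(_ a) := AB c.
by rewrite -!colE !mxE.
Qed.

Lemma covD_delta b (Y : cvfield R d) x :
  covD G (fun=> delta_mx b 0) Y x = cpartial_cv b Y x + toC (Gam b x) *m Y x.
Proof.
rewrite covDE (bigD1 b)//= big1 ?addr0 => [|c /negPf cb].
  by rewrite mxE !eqxx scale1r.
by rewrite mxE cb scale0r.
Qed.

Lemma toC_inj m n : injective (@toC R m n).
Proof.
by move=> A B /matrixP AB; apply/matrixP => i j; have := AB i j; rewrite !mxE; case.
Qed.

Lemma christoffel_sym x b c a :
  (forall X Y, smooth_cvfield U X -> smooth_cvfield U Y -> torsion G X Y x = 0) ->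
  Gam b x a c = Gam c x a b.
Proof.
move=> tf.
have := tf _ _ (smooth_cvfield_cst (delta_mx b 0)) (smooth_cvfield_cst (delta_mx c 0)).
rewrite /torsion lieE big1 ?subr0 => [|e _]; last first.
  by rewrite !cpartial_cv_cst !scaler0 subrr.
rewrite !covD_delta !cpartial_cv_cst !add0r -!colE => /eqP; rewrite subr_eq0 => /eqP.
by move/colP/(_ a); rewrite !mxE => -[].
Qed.

(** Testing parallelism on constant coordinate fields determines the matrix d_b A + [Gamma_b, A]
    column by column. *)
Lemma parallel_endo_mx (A : 'cV[R]_d -> 'M[R]_d) x b : U x -> smooth_mx U A ->
  (forall X Y, smooth_cvfield U X -> smooth_cvfield U Y ->
    covD G X (apply_field A Y) x = toC (A x) *m covD G X Y x) ->
  partial_mx b A x = A x *m Gam b x - Gam b x *m A x.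
Proof.
move=> Ux sA par; apply/eqP; rewrite eq_sym subr_eq eq_sym; apply/eqP.
apply: toC_inj; apply: eq_mulmx_delta => c.
have := par _ _ (smooth_cvfield_cst (delta_mx b 0)) (smooth_cvfield_cst (delta_mx c 0)).
rewrite !covD_delta cpartial_cv_cst add0r /apply_field.
(* The rule for sums is used with a single summand. *)
have := @cpartial_cv_sum_toCM _ _ b 1 _ (fun=> A) (fun=> delta_mx c 0) x
  (fun=> smooth_mx_derivable sA Ux).
have -> : (fun y => \sum_(k < 1) toC (A y) *m (delta_mx c 0 : 'cV[C]_d)) =
          (fun y => toC (A y) *m delta_mx c 0).
  by apply/funext => y; rewrite big_ord1.
rewrite big_ord1 => ->.
by rewrite !mulmxA -mulmxDl -!toC_mul /toC -map_mxD.
Qed.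

Lemma curv_mx_anti x b c : curv_mx G x b c = - curv_mx G x c b.
Proof. by rewrite /curv_mx opprD !opprB. Qed.

(** Symmetry of Gamma in its lower indices lets j be exchanged with the column index in both d_i
    Gamma_j and Gamma_i Gamma_j. After that the cyclic sum cancels term by term. *)
Lemma curv_mx_bianchi x a b c e : U x ->
  (forall y, U y -> forall b c a, Gam b y a c = Gam c y a b) ->
  curv_mx G x b c a e + curv_mx G x c e a b + curv_mx G x e b a c = 0.
Proof.
move=> Ux sym.
have dsym i j k : partial_mx i (Gam j) x a k = partial_mx i (Gam k) x a j.
  by rewrite !mxE; apply: (eq_partial _ Uo Ux) => y Uy; rewrite sym.
have msym i j k : (Gam i x *m Gam j x) a k = (Gam i x *m Gam k x) a j.
  by rewrite !mxE; apply: eq_bigr => l _; rewrite [Gam j x l k]sym.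
have E i j k : curv_mx G x i j a k =
    partial_mx i (Gam j) x a k - partial_mx j (Gam i) x a k
    + ((Gam i x *m Gam j x) a k - (Gam j x *m Gam i x) a k).
  rewrite /curv_mx; move: (partial_mx i _ x) (partial_mx j _ x) => P Q.
  by move: (Gam i x *m _) (Gam j x *m _) => S T; rewrite !mxE.
rewrite !E (dsym b c e) (dsym c e b) (dsym e b c).
rewrite (msym b c e) (msym c e b) (msym e b c).
by lra.
Qed.

(** This is the integrability condition of d_b A = [A, Gamma_b]: expand both mixed second partials
    of A by this equation and equate them. *)
Lemma curv_mx_comm (A : 'cV[R]_d -> 'M[R]_d) x b c : U x -> smooth_mx U A ->
  (forall y, U y -> forall b, partial_mx b A y = A y *m Gam b y - Gam b y *m A y) ->
  curv_mx G x b c *m A x = A x *m curv_mx G x b c.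
Proof.
move=> Ux sA par.
have dA i : entrywise_derivable A x i by exact: smooth_mx_derivable sA Ux.
have dd i j : partial_mx i (partial_mx j A) x =
    partial_mx i A x *m Gam j x + A x *m partial_mx i (Gam j) x
    - (partial_mx i (Gam j) x *m A x + Gam j x *m partial_mx i A x).
  rewrite (eq_dmx _ Uo Ux (fun y Uy => par y Uy j)).
  have dG k := @dGam x j k Ux.
  rewrite (partial_mxB (derivable_mulmx (dA i) (dG i)) (derivable_mulmx (dG i) (dA i))).
  by rewrite (partial_mxM (dA i) (dG i)) (partial_mxM (dG i) (dA i)).
have := partial_mx_comm b c Uo Ux sA; rewrite !dd !par// /curv_mx.
by mulmx_linear.
Qed.

(** The same integrability argument, now for the equation of a parallel metric. *)
Lemma curv_mx_metric (g : 'cV[R]_d -> 'M[R]_d) x b c : U x -> smooth_mx U g ->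
  (forall y, U y -> forall b, partial_mx b g y = (Gam b y)^T *m g y + g y *m Gam b y) ->
  (curv_mx G x b c)^T *m g x + g x *m curv_mx G x b c = 0.
Proof.
move=> Ux sg par.
have dg i : entrywise_derivable g x i by exact: smooth_mx_derivable sg Ux.
have dd i j : partial_mx i (partial_mx j g) x =
    (partial_mx i (Gam j) x)^T *m g x + (Gam j x)^T *m partial_mx i g x
    + (partial_mx i g x *m Gam j x + g x *m partial_mx i (Gam j) x).
  rewrite (eq_dmx _ Uo Ux (fun y Uy => par y Uy j)).
  have dG k := @dGam x j k Ux; have dGT k := derivable_trmx (dG k).
  rewrite (partial_mxD (derivable_mulmx (dGT i) (dg i))
    (derivable_mulmx (dg i) (dG i))).
  by rewrite (partial_mxM (dGT i) (dg i)) (partial_mxM (dg i) (dG i)) partial_mx_tr.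
have := partial_mx_comm b c Uo Ux sg; rewrite !dd !par// /curv_mx.
rewrite [(_ + _)^T]linearD /= !trmxB !trmx_mul.
by mulmx_linear.
Qed.

End LocalGeometry.

(** * Hyperkahler metrics are parallel for the Obata connection *)

Section ParallelMetric.
Variables (R : realType) (d : nat) (U : set 'cV[R]_d).
Variable G : christoffel_array R d.
Hypothesis Uo : open U.
Local Notation C := R[i].
Local Notation Gam := (christoffel_mx G).
Variable g : 'cV[R]_d -> 'M[R]_d.
Hypotheses (sg : smooth_mx U g) (gs : forall y, U y -> (g y)^T = g y).

Let nabla_g a x : 'M[R]_d := partial_mx a g x - (Gam a x)^T *m g x - g x *m Gam a x.

Section OneStructure.
Variable A : 'cV[R]_d -> 'M[R]_d.
Hypotheses (sA : smooth_mx U A)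
  (AA : forall y, U y -> A y *m A y = - 1%:M)
  (Ag : forall y, U y -> (A y)^T *m g y *m A y = g y)
  (parA : forall y, U y -> forall b,
    partial_mx b A y = A y *m Gam b y - Gam b y *m A y).

(** The relation A^T g A = g is differentiated covariantly, with nabla A = 0. *)
Lemma nabla_metric_invariant x a : U x ->
  (A x)^T *m nabla_g a x *m A x = nabla_g a x.
Proof.
move=> Ux; have dA : entrywise_derivable A x a := smooth_mx_derivable sA Ux.
have dg : entrywise_derivable g x a := smooth_mx_derivable sg Ux.
have dAT := derivable_trmx dA.
have := eq_dmx a Uo Ux Ag.
rewrite (partial_mxM (derivable_mulmx dAT dg) dA) (partial_mxM dAT dg).
rewrite partial_mx_tr parA//.
(* These two multiples of the relation account for the connection terms of nabla g. *)
have := congr1 (mulmx (Gam a x)^T) (Ag Ux).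
have := congr1 (mulmx^~ (Gam a x)) (Ag Ux).
rewrite /nabla_g trmxB !trmx_mul.
by mulmx_linear.
Qed.

Lemma fundamental_form_anti y : U y -> ((A y)^T *m g y)^T = - ((A y)^T *m g y).
Proof.
move=> Uy; rewrite trmx_mul trmxK gs// -{1}[g y]Ag// -!mulmxA AA//.
by rewrite !mulmxN mulmx1.
Qed.

(** For a torsion-free connection, the exterior derivative of w is the cyclic sum of nabla w, and
    nabla w = A^T nabla g because A is parallel. *)
Lemma cyclic_nabla_metric x a b c : U x ->
  (forall y, U y -> forall b c f, Gam b y f c = Gam c y f b) ->
  (let w := fun y => (A y)^T *m g y in
   partial_mx a w x b c + partial_mx b w x c a + partial_mx c w x a b = 0) ->
  ((A x)^T *m nabla_g a x) b c + ((A x)^T *m nabla_g b x) c a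
  + ((A x)^T *m nabla_g c x) a b = 0.
Proof.
move=> Ux sym /=; set w := fun y => _.
have E e : (A x)^T *m nabla_g e x =
    partial_mx e w x - (Gam e x)^T *m w x - w x *m Gam e x.
  have dA : entrywise_derivable A x e := smooth_mx_derivable sA Ux.
  have dg : entrywise_derivable g x e := smooth_mx_derivable sg Ux.
  rewrite (partial_mxM (derivable_trmx dA) dg) partial_mx_tr parA// /w /nabla_g trmxB.
  rewrite !trmx_mul.
  by apply/eqP; rewrite -subr_eq0; apply/eqP; mulmx_linear.
(* Skewness of w and symmetry of Gamma make the connection terms cancel in pairs around the
   cycle. *)
have anti e f h : ((Gam e x)^T *m w x) f h = - (w x *m Gam f x) h e.
  rewrite !mxE -sumrN; apply: eq_bigr => k _.
  have /matrixP/(_ h k) := fundamental_form_anti Ux.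
  rewrite mxE [RHS]mxE -/(w x) => ->.
  by rewrite mxE [Gam f x k e]sym// mulrN mulrC.
rewrite !E; move: (anti a b c) (anti b c a) (anti c a b).
move: (_ *m w x) (_ *m w x) (_ *m w x) (w x *m _) (w x *m _) (w x *m _).
move: (partial_mx a w x) (partial_mx b w x) (partial_mx c w x).
move=> D1 D2 D3 P1 P2 P3 Q1 Q2 Q3.
by rewrite !mxE; lra.
Qed.

End OneStructure.

Lemma dform2_half (A B : 'cV[R]_d -> 'M[R]_d) x a b c :
  (forall i, entrywise_derivable A x i) -> (forall i, entrywise_derivable B x i) ->
  dform2 (fun y => 2^-1 *: (toC (A y) + 'i%C *: toC (B y))) x a b c = 0 ->
  partial_mx a A x b c + partial_mx b A x c a + partial_mx c A x a b = 0 /\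
  partial_mx a B x b c + partial_mx b B x c a + partial_mx c B x a b = 0.
Proof.
move=> dA dB.
have E i j k : cpartial i (fun y => (2^-1 *: (toC (A y) + 'i%C *: toC (B y))) j k) x
    = (2^-1 * partial_mx i A x j k +i* (2^-1 * partial_mx i B x j k))%C.
  have h (y : 'cV[R]_d) : (2^-1 *: (toC (A y) + 'i%C *: toC (B y))) j k =
      (2^-1 * A y j k +i* (2^-1 * B y j k))%C.
    have -> : (2^-1 : C) = (2^-1)%:C%C by rewrite fmorphV rmorph_nat.
    rewrite !mxE; apply/eqP; rewrite eq_complex /=; apply/andP; split; apply/eqP; ring.
  rewrite /cpartial; congr (_ +i* _)%C.
  - rewrite (_ : (fun y => _) = 2^-1 \*o (fun y => A y j k)); last first.
      by apply/funext => y; rewrite h.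
    rewrite /partial deriveMl ?[partial_mx _ _ _ _ _]mxE//; exact: dA.
  - rewrite (_ : (fun y => _) = 2^-1 \*o (fun y => B y j k)); last first.
      by apply/funext => y; rewrite h.
    rewrite /partial deriveMl ?[partial_mx _ _ _ _ _]mxE//; exact: dB.
rewrite /dform2 !E => -[]; lra.
Qed.

(** The real and imaginary parts of d Omega = 0 close the forms of J and K. They become cyclic
    identities for nabla g, to which [quaternionic_cyclic_eq0] applies. *)
Lemma hyperkahler_parallel (I J K : 'cV[R]_d -> 'M[R]_d) :
  smooth_mx U I -> smooth_mx U J -> smooth_mx U K ->
  (forall y, U y -> forall b c f, Gam b y f c = Gam c y f b) ->
  (forall y, U y -> [/\ I y *m I y = - 1%:M, J y *m J y = - 1%:M,
     K y *m K y = - 1%:M, I y *m J y = K y & J y *m I y = - K y]) ->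
  (forall y, U y -> [/\ (I y)^T *m g y *m I y = g y,
     (J y)^T *m g y *m J y = g y & (K y)^T *m g y *m K y = g y]) ->
  (forall y, U y -> forall b, [/\
     partial_mx b I y = I y *m Gam b y - Gam b y *m I y,
     partial_mx b J y = J y *m Gam b y - Gam b y *m J y &
     partial_mx b K y = K y *m Gam b y - Gam b y *m K y]) ->
  (forall y, U y -> forall a b c, dform2 (fun y => 2^-1 *:
     (toC ((J y)^T *m g y) + 'i%C *: toC ((K y)^T *m g y))) y a b c = 0) ->
  forall x, U x -> forall a, partial_mx a g x = (Gam a x)^T *m g x + g x *m Gam a x.
Proof.
move=> sI sJ sK sym quat herm par dO x Ux a.
have [II JJ KK IJ JI] := quat x Ux.
suff : nabla_g a x = 0.
  by move/eqP; rewrite /nabla_g -addrA -opprD subr_eq0 => /eqP.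
have dform (A : 'cV[R]_d -> 'M[R]_d) i : smooth_mx U A ->
    entrywise_derivable (fun y => (A y)^T *m g y) x i.
  move=> sA; apply: derivable_mulmx; last exact: smooth_mx_derivable sg Ux.
  by apply: derivable_trmx; exact: smooth_mx_derivable sA Ux.
have dOx b c e := dform2_half (fun i => dform J i sJ) (fun i => dform K i sK)
  (dO x Ux b c e).
apply: (@quaternionic_cyclic_eq0 _ _ (fun e => nabla_g e x) (I x) (J x)).
- move=> e; apply: nabla_metric_invariant Ux => // y Uy; first by case: (herm y Uy).
  by move=> b; case: (par y Uy b).
- move=> e; apply: nabla_metric_invariant Ux => // y Uy; first by case: (herm y Uy).
  by move=> b; case: (par y Uy b).
- by [].
- by [].
- by rewrite IJ JI.
- move=> b c e; apply: (@cyclic_nabla_metric J) => //.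
  + by move=> y Uy; case: (quat y Uy).
  + by move=> y Uy; case: (herm y Uy).
  + by move=> y Uy f; case: (par y Uy f).
  + exact: (dOx b c e).1.
- move=> b c e; rewrite IJ; apply: (@cyclic_nabla_metric K) => //.
  + by move=> y Uy; case: (quat y Uy).
  + by move=> y Uy; case: (herm y Uy).
  + by move=> y Uy f; case: (par y Uy f).
  + exact: (dOx b c e).2.
Qed.

End ParallelMetric.

(** * Inverses of invariant metrics *)

Lemma posdef_unitmx (F : realFieldType) d (g : 'M[F]_d) :
  (forall v : 'cV[F]_d, v != 0 -> 0 < (v^T *m g *m v) 0 0) -> g \in unitmx.
Proof.
move=> pos; rewrite unitmxE unitfE; apply/negP => /det0P[v v0 vg].
have vT : v^T != 0 by rewrite -trmx0 (inj_eq trmx_inj).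
by have := pos _ vT; rewrite trmxK vg mul0mx mxE ltxx.
Qed.

(** Since A A = -1, invariance reads g A = - A^T g, which makes A g^{-1} A^T a right inverse of
    g. *)
Lemma invmx_invariant (F : fieldType) d (g A : 'M[F]_d) : g \in unitmx ->
  A *m A = - 1%:M -> A^T *m g *m A = g -> A *m invmx g *m A^T = invmx g.
Proof.
move=> gu AA Ag; have gA : g *m A = - (A^T *m g).
  rewrite -[in RHS]Ag !mulmxA -trmx_mul AA linearN /= trmx1.
  by rewrite mulNmx mul1mx mulNmx opprK.
have gAHA : g *m (A *m invmx g *m A^T) = 1%:M.
  rewrite !mulmxA gA !mulNmx -[A^T *m g *m _]mulmxA mulmxV// mulmx1.
  by rewrite -trmx_mul AA linearN /= trmx1 opprK.
by rewrite -[LHS]mul1mx -(mulVmx gu) -[LHS]mulmxA gAHA mulmx1.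
Qed.

(** * Curvature traces of the Obata connection in a holomorphic chart *)

Section Chart.
Variables (R : realType) (N : nat) (M : smooth_manifold R (N + N)).
Variables (I J K : endo_field M) (nabla : affine_connection M).
Hypotheses (hM : hypercomplex I J K) (hnabla : obata nabla I J K).
Variables (z : chart R (N + N) M) (hz : atlas z).

Let U := cod z.

Let Uo : open U. Proof. by rewrite /U; case: z. Qed.

Let to_cod p : dom z p -> U (to z p).
Proof. by rewrite /U; case: z => D C t f _ _ /= h _ _ _ /h[]. Qed.

Let smooth_endo (A : endo_field M) : smooth_mx U (A z).
Proof. by case: A => A sA ? a b /=; exact: sA. Qed.

Let smooth_metric (g : riemannian_metric M) : smooth_mx U (g z).
Proof. by case: g => g sg *; exact: sg. Qed.

Let metric_sym (g : riemannian_metric M) y : U y -> (g z y)^T = g z y.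
Proof. by case: g => g ? sg * /=; exact: sg. Qed.

Let metric_unit (g : riemannian_metric M) y : U y -> g z y \in unitmx.
Proof. by case: g => g ? ? pos ? Uy /=; apply: posdef_unitmx; exact: pos. Qed.

Let smooth_christoffel a i j : smooth U (fun x => nabla z x a i j).
Proof. by case: nabla => G sG ? /=; exact: sG. Qed.

Let quat y : U y -> [/\ I z y *m I z y = - 1%:M, J z y *m J z y = - 1%:M,
   K z y *m K z y = - 1%:M, I z y *m J z y = K z y & J z y *m I z y = - K z y].
Proof.
case: hM => -[II _] [JJ _] [KK _] IJ Uy; have [e1 e2] := IJ z y hz Uy.
by split; rewrite ?II ?JJ ?KK// -e2 opprK.
Qed.

Let sym y : U y -> forall b c a, christoffel_mx (nabla z) b y a c =
  christoffel_mx (nabla z) c y a b.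
Proof.
case: hnabla => tf _ _ _ Uy b c a.
by apply: (@christoffel_sym _ _ U) => X Y; exact: tf.
Qed.

Let parallel_mx A : parallel_endo nabla A -> forall y, U y -> forall b,
  partial_mx b (A z) y = A z y *m christoffel_mx (nabla z) b y
                  - christoffel_mx (nabla z) b y *m A z y.
Proof.
move=> pA y Uy b; apply: (@parallel_endo_mx _ _ U) => // X Y; exact: pA.
Qed.

Let Rm (y : 'cV[R]_(N + N)) := curv_mx (nabla z) y.

Let Rm_anti y b c : Rm y b c = - Rm y c b.
Proof. exact: curv_mx_anti. Qed.

Let Rm_bianchi y : U y -> forall a b c e,
  Rm y b c a e + Rm y c e a b + Rm y e b a c = 0.
Proof. by move=> Uy a b c e; apply: (curv_mx_bianchi Uo). Qed.

Let Rm_comm A : parallel_endo nabla A -> forall y, U y -> forall b c,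
  Rm y b c *m A z y = A z y *m Rm y b c.
Proof.
by move=> pA y Uy b c; apply: (curv_mx_comm Uo) => //; exact: parallel_mx.
Qed.

(** J-invariance of the inverse metric feeds [bicontract_invariant]; I-invariance makes it of mixed
    type in the complex frame. *)
Let inverse_metric_facts (g : riemannian_metric M) y : hyperhermitian g I J K ->
  U y -> let H := invmx (g z y) in
  [/\ I z y *m H *m (I z y)^T = H, H^T = H, bicontract (Rm y) H = 0 &
      bicontract (Rm y) (I z y *m H) = 0].
Proof.
case=> gI gJ _ Uy H; have [II JJ _ IJ JI] := quat Uy.
have gu := metric_unit g Uy; have [_ pI pJ _] := hnabla.
have Hs : H^T = H by rewrite /H trmx_inv metric_sym.
have HJ : J z y *m H *m (J z y)^T = H by apply: invmx_invariant => //; exact: gJ.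
have [] := bicontract_invariant (Rm_anti y) (Rm_bianchi Uy)
  (Rm_comm pI Uy) (Rm_comm pJ Uy) II JJ _ Hs HJ; first by rewrite IJ JI.
by split=> //; apply: invmx_invariant => //; exact: gI.
Qed.

(** A hyperkahler metric is parallel, so its lowered curvature is skew in the last pair and
    [pair_symmetry] applies. *)
Let Rm_pair (g : riemannian_metric M) y : hyperkahler g I J K -> U y ->
  forall b c e f, (g z y *m Rm y b c) e f = (g z y *m Rm y e f) b c.
Proof.
case=> -[gI gJ gK] dO Uy; have [_ pI pJ pK] := hnabla.
apply: (pair_symmetry (Rm_anti y) (Rm_bianchi Uy)); last exact: metric_sym.
move=> b c; apply: (curv_mx_metric Uo) => //.
apply: (hyperkahler_parallel Uo _ _ (smooth_endo I) (smooth_endo J) (smooth_endo K)).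
- exact: smooth_metric.
- by move=> x; exact: metric_sym.
- exact: sym.
- exact: quat.
- by move=> x Ux; split; [exact: gI|exact: gJ|exact: gK].
- by move=> x Ux a; split; exact: parallel_mx.
- by move=> x Ux; exact: dO.
Qed.

Variables (x0 : M) (hx0 : dom z x0) (hol : holomorphic_chart I z).

Let Ux0 := to_cod hx0.

Let curv_compE j k l i : curv_comp nabla z x0 j k l i =
  (ccoframe (inr i) *m
   (bicontract (fun b c => toC (Rm (to z x0) b c))
      (cframe (inr j) *m (cframe (inl k))^T) *m cframe (inr l))) 0 0.
Proof.
rewrite /curv_comp; congr ((_ *m _) 0 0); apply: curvature_cst => b c a e.
have -> : (fun y => christoffel_mx (nabla z) b y a e) = fun y => nabla z y a b e.
  by apply/funext => y; rewrite mxE.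
exact: smooth_derivable (smooth_christoffel a b e) Ux0.
Qed.

(** This is [sum_curvature_eq0] for the covector d zbar^a and the vector d/d zbar^q. *)
Lemma trace_curvature_eq0 (g : riemannian_metric M) : hyperhermitian g I J K ->
  forall q a : 'I_N, \sum_i \sum_j
    metric_inv g z x0 i j * curv_comp nabla z x0 j i q a = 0.
Proof.
move=> hg q a; have [HI Hs RH RIH] := inverse_metric_facts hg Ux0.
have [gI _ _] := hg.
have E := sum_curvature_eq0 (hol Ux0) (gI z _ hz Ux0) HI Hs
  (mulmxV (metric_unit g Ux0)) RH RIH (Rm_anti _) (ccoframe (inr a)) (cframe (inr q)).
rewrite -[RHS]E; apply: eq_bigr => i _; apply: eq_bigr => j _.
by rewrite curv_compE.
Qed.

Lemma lowered_trace_curvature_eq0 (ghat g : riemannian_metric M) :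
  hyperkahler ghat I J K -> hyperhermitian g I J K ->
  forall r s : 'I_N, \sum_i \sum_j \sum_k
    metric_inv g z x0 i j * metric_comp ghat z x0 i k *
    curv_comp nabla z x0 s r j k = 0.
Proof.
move=> hk hg r s; have [HI Hs RH RIH] := inverse_metric_facts hg Ux0.
have [gI _ _] := hg; have [[ghI _ _] _] := hk.
have E := sum_lowered_curvature_eq0 (hol Ux0) (gI z _ hz Ux0) HI Hs
  (mulmxV (metric_unit g Ux0)) RH RIH r s (ghI z _ hz Ux0) (Rm_pair hk Ux0).
rewrite -[RHS]E; apply: eq_bigr => i _; apply: eq_bigr => j _; apply: eq_bigr => k _.
by rewrite curv_compE [metric_comp _ _ _ _ _]mxE.
Qed.

End Chart.

Theorem lemma3p2 (R : realType) (n : nat)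
    (M : smooth_manifold R (2 * n + 2 * n)) (I J K : endo_field M)
    (hM : hypercomplex I J K)
    (nabla : affine_connection M) (hnabla : obata nabla I J K)
    (x0 : M) (z : chart R (2 * n + 2 * n) M)
    (hz : atlas z) (hx0 : dom z x0) (hol : holomorphic_chart I z)
    (geo : geodesic_at nabla z x0) :
  (forall g : riemannian_metric M, hyperhermitian g I J K ->
   forall q a : 'I_(2 * n),
   \sum_(i < 2 * n) \sum_(j < 2 * n)
     metric_inv g z x0 i j * curv_comp nabla z x0 j i q a = 0)
  /\
  (forall ghat : riemannian_metric M, hyperkahler ghat I J K ->
   forall g : riemannian_metric M, hyperhermitian g I J K ->
   forall r s : 'I_(2 * n),
   \sum_(i < 2 * n) \sum_(j < 2 * n) \sum_(k < 2 * n)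
     metric_inv g z x0 i j * metric_comp ghat z x0 i k *
     curv_comp nabla z x0 s r j k = 0).
Proof.
split=> [g hg | ghat hk g hg].
  exact: (trace_curvature_eq0 hM hnabla hz hx0 hol hg).
exact: (lowered_trace_curvature_eq0 hM hnabla hz hx0 hol hk hg).
Qed.
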